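(* Let $N>1$, let $\beta\in\mathbb{C}^N$, and let $V$ be any irreducible $\mathfrak{gl}_N$-module (not necessarily a weight module). If $V\ncong\Lambda^k\mathbb{C}^N$ for every $0\leq k\leq N$, then $F^\beta_{\mathcal{W}}(V)$ is an irreducible $\mathcal{W}_N$-module.
   Context: All over $\mathbb{C}$. $\mathbb{C}^N$ is the space of column vectors, $(u|v)=u^Tv$, $A_N=\mathbb{C}[t_1^{\pm1},\ldots,t_N^{\pm1}]$, $t^k=t_1^{k_1}\cdots t_N^{k_N}$ for $k\in\mathbb{Z}^N$, $d_i=t_i\partial/\partial t_i$, $D(u,r)=\sum_iu_it^rd_i$ for $u\in\mathbb{C}^N$, $r\in\mathbb{Z}^N$. $\mathcal{W}_N=\mathrm{Der}(A_N)=\mathrm{span}\{D(u,r)\}$. For a $\mathfrak{gl}_N$-module $V$, $F^\beta_{\mathcal{W}}(V)=V\otimes A_N$ with $D(u,r)(v\otimes t^k)=(u|k+\beta)v\otimes t^{k+r}+(ru^T)v\otimes t^{k+r}$. $\Lambda^k\mathbb{C}^N$ denotes the $k$-th exterior power of the natural $\mathfrak{gl}_N$-module, with $\Lambda^0\mathbb{C}^N=\mathbb{C}$ trivial (in the paper's notation $\Lambda^k\mathbb{C}^N\cong V(\delta_k,k)$, the irreducible $\mathfrak{sl}_N$-module with highest weight $\delta_k$, on which the identity matrix acts by $k$, $\delta_0=\delta_N=0$). *)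

(* Defs.v *)
From HB Require Import structures.
From mathcomp Require Import all_boot all_order all_algebra.
From mathcomp Require Import finmap complex.
From mathcomp Require Import boolp functions reals.
From mathcomp Require Import ring.

Set Implicit Arguments.
Unset Strict Implicit.
Unset Printing Implicit Defensive.

Import GRing.Theory.
Local Open Scope fset_scope.
Local Open Scope ring_scope.

Section LieModule.
Variables (F : fieldType) (L : lmodType F) (br : L -> L -> L).

Definition lie_module (V : lmodType F) (act : L -> V -> V) : Prop :=
  [/\ forall v, linear (act^~ v),
      forall x, linear (act x) &
      forall x y v, act (br x y) v = act x (act y v) - act y (act x v)].

Definition submodule (V : lmodType F) (act : L -> V -> V) (U : V -> Prop) :=
  [/\ U 0,
      forall a u v, U u -> U v -> U (a *: u + v) &
      forall x u, U u -> U (act x u)].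

Definition irreducible_module (V : lmodType F) (act : L -> V -> V) : Prop :=
  [/\ lie_module act,
      exists v : V, v <> 0 &
      forall U, submodule act U ->
        (forall u, U u -> u = 0) \/ (forall u, U u)].

Definition isomorphic_modules (V V' : lmodType F)
    (act : L -> V -> V) (act' : L -> V' -> V') : Prop :=
  exists f : {linear V -> V'},
    bijective f /\ forall x v, f (act x v) = act' x (f v).

End LieModule.

Definition gl_bracket (F : fieldType) (N : nat) (A B : 'M[F]_N) : 'M[F]_N :=
  A *m B - B *m A.

(* Exterior power of the natural gl_N-module F^N, in coordinates: the basis
   vector e_(s 0) /\ ... /\ e_(s (k-1)) is indexed by the increasing k-tuple s,
   and the coordinates of u_0 /\ ... /\ u_(k-1) are the maximal minors of the
   matrix with columns u_j.  A matrix A acts as a derivation: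
   u_0 /\ ... /\ u_(k-1) |-> sum_j u_0 /\ ... /\ A u_j /\ ... /\ u_(k-1). *)
Section ExteriorPower.
Variables (F : fieldType) (N k : nat).

Definition incr_tuple : Type :=
  {s : k.-tuple 'I_N | sorted ltn (map val s)}.

HB.instance Definition _ := Finite.on incr_tuple.

Definition ext_power : Type := {ffun incr_tuple -> F^o}.

HB.instance Definition _ := GRing.Lmodule.on ext_power.

Definition wedge (M : 'M[F]_(N, k)) : ext_power :=
  [ffun s : incr_tuple => \det (rowsub (tnth (val s)) M)].

Definition ext_basis (s : incr_tuple) : 'M[F]_(N, k) :=
  colsub (tnth (val s)) 1%:M.

Definition act_on_col (A : 'M[F]_N) (j : 'I_k) (M : 'M[F]_(N, k)) :=
  \matrix_(a, b) (if b == j then (A *m M) a b else M a b).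

Definition ext_act (A : 'M[F]_N) (x : ext_power) : ext_power :=
  \sum_s x s *: \sum_(j < k) wedge (act_on_col A j (ext_basis s)).

End ExteriorPower.

(* V (x) A_N: since the t^k form a basis of A_N, its elements are the finitely
   supported functions Z^N -> V; [tmon v k] is v (x) t^k. *)
Section Tensor.
Variables (F : fieldType) (V : lmodType F) (N : nat).

Definition tens : Type := {fsfun 'cV[int]_N -> V with 0}.

HB.instance Definition _ := Choice.on tens.

Definition tcoef (x : tens) (k : 'cV[int]_N) : V := (x : {fsfun _ with _}) k.
Definition tsupp (x : tens) : {fset 'cV[int]_N} := finsupp x.

Definition tmon (v : V) (k : 'cV[int]_N) : tens := [fsfun l in [fset k] => v].

Definition tens_add (x y : tens) : tens :=
  [fsfun k in tsupp x `|` tsupp y => tcoef x k + tcoef y k].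

Definition tens_opp (x : tens) : tens :=
  [fsfun k in tsupp x => - tcoef x k].

Definition tens_scale (c : F) (x : tens) : tens :=
  [fsfun k in tsupp x => c *: tcoef x k].

Lemma tensP (x y : tens) : (forall k, tcoef x k = tcoef y k) <-> x = y.
Proof. exact: fsfunP. Qed.

Lemma tcoef_dflt (x : tens) k : k \notin tsupp x -> tcoef x k = 0.
Proof. exact: fsfun_dflt. Qed.

Lemma tcoef_mon v k l : tcoef (tmon v k) l = if l == k then v else 0.
Proof. by rewrite /tcoef fsfun_fun in_fset1. Qed.

Lemma tsupp_mon v k : tsupp (tmon v k) `<=` [fset k].
Proof.
apply/fsubsetP => l; rewrite in_fset1 mem_finsupp -/(tcoef _ l) tcoef_mon.
by case: (l == k); rewrite ?eqxx.
Qed.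

Fact tcoef_add x y k : tcoef (tens_add x y) k = tcoef x k + tcoef y k.
Proof.
rewrite {1}/tcoef fsfun_fun in_fsetU; case: ifP => // /norP[xk yk].
by rewrite !tcoef_dflt ?addr0.
Qed.

Fact tcoef_opp x k : tcoef (tens_opp x) k = - tcoef x k.
Proof.
rewrite {1}/tcoef fsfun_fun; case: ifP => // /negbT xk.
by rewrite tcoef_dflt ?oppr0.
Qed.

Fact tcoef_scale c x k : tcoef (tens_scale c x) k = c *: tcoef x k.
Proof.
rewrite {1}/tcoef fsfun_fun; case: ifP => // /negbT xk.
by rewrite tcoef_dflt ?scaler0.
Qed.

Fact tcoef_fs0 k : tcoef [fsfun] k = 0.
Proof. exact: fsfun0E. Qed.

Fact tens_addA : associative tens_add.
Proof. by move=> x y z; apply/tensP => k; rewrite !tcoef_add addrA. Qed.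

Fact tens_addC : commutative tens_add.
Proof. by move=> x y; apply/tensP => k; rewrite !tcoef_add addrC. Qed.

Fact tens_add0 : left_id ([fsfun] : tens) tens_add.
Proof. by move=> x; apply/tensP => k; rewrite tcoef_add tcoef_fs0 add0r. Qed.

Fact tens_addN : left_inverse ([fsfun] : tens) tens_opp tens_add.
Proof.
by move=> x; apply/tensP => k; rewrite tcoef_add tcoef_opp tcoef_fs0 addNr.
Qed.

HB.instance Definition _ := GRing.isZmodule.Build tens
  tens_addA tens_addC tens_add0 tens_addN.

Fact tens_scaleA a b x : tens_scale a (tens_scale b x) = tens_scale (a * b) x.
Proof. by apply/tensP => k; rewrite !tcoef_scale scalerA. Qed.

Fact tens_scale1 : left_id 1 tens_scale.
Proof. by move=> x; apply/tensP => k; rewrite tcoef_scale scale1r. Qed.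

Fact tens_scaleDr : right_distributive tens_scale +%R.
Proof.
by move=> a x y; apply/tensP => k; rewrite !(tcoef_add, tcoef_scale) scalerDr.
Qed.

Fact tens_scaleDl x : {morph tens_scale^~ x : a b / a + b}.
Proof.
by move=> a b; apply/tensP => k; rewrite !(tcoef_add, tcoef_scale) scalerDl.
Qed.

HB.instance Definition _ := GRing.Zmodule_isLmodule.Build F tens
  tens_scaleA tens_scale1 tens_scaleDr tens_scaleDl.

Lemma tcoefD x y k : tcoef (x + y) k = tcoef x k + tcoef y k.
Proof. exact: tcoef_add. Qed.

Lemma tcoefZ c x k : tcoef (c *: x) k = c *: tcoef x k.
Proof. exact: tcoef_scale. Qed.

Lemma tmon_linear k : linear (tmon^~ k).
Proof.
move=> a u v; apply/tensP => l.
by rewrite tcoefD tcoefZ !tcoef_mon; case: eqP; rewrite // scaler0 addr0.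
Qed.

Lemma tensE (x : tens) : x = \sum_(k <- tsupp x) tmon (tcoef x k) k.
Proof.
apply/tensP => l; rewrite (big_morph (tcoef^~ l) (fun x y => tcoefD x y l)
  (tcoef_fs0 l)).
have [xl|xl] := boolP (l \in tsupp x).
  rewrite (big_fsetD1 l) //= tcoef_mon eqxx big1_fset ?addr0 // => k.
  by rewrite in_fsetD1 tcoef_mon eq_sym => /andP[/negPf->].
rewrite tcoef_dflt // big1_fset // => k kx _; rewrite tcoef_mon.
by case: eqP xl => // ->; rewrite kx.
Qed.

End Tensor.

Section LinearExtension.
Variables (F : fieldType) (V W : lmodType F) (N : nat).
Variable phi : 'cV[int]_N -> V -> W.
Hypothesis phiL : forall k, linear (phi k).

Let phi0 k : phi k 0 = 0.
Proof.
by have := phiL k (-1) 0 0; rewrite scaleN1r oppr0 addr0 scaleN1r addNr.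
Qed.

Lemma tens_ext_sub (x : tens V N) (d : {fset 'cV[int]_N}) :
  tsupp x `<=` d ->
  \sum_(k <- tsupp x) phi k (tcoef x k) = \sum_(k <- d) phi k (tcoef x k).
Proof. by move=> sd; apply/big_fset_incl => // k _ /tcoef_dflt ->. Qed.

Lemma tens_ext_linear :
  linear (fun x : tens V N => \sum_(k <- tsupp x) phi k (tcoef x k)).
Proof.
move=> a x y; pose d := tsupp x `|` tsupp y `|` tsupp (a *: x + y).
rewrite !(@tens_ext_sub _ d); first last.
1-3: by apply/fsubsetP => k kx; rewrite !in_fsetU kx ?orbT.
rewrite scaler_sumr -big_split /=; apply: eq_bigr => k _.
by rewrite tcoefD tcoefZ phiL.
Qed.

Lemma tens_extU k v :
  let x := tmon v k : tens V N in
  \sum_(l <- tsupp x) phi l (tcoef x l) = phi k v.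
Proof.
move=> x; rewrite (@tens_ext_sub x [fset k]) ?tsupp_mon //.
by rewrite big_seq_fset1 tcoef_mon eqxx.
Qed.

End LinearExtension.

Lemma tens_linear_eq (F : fieldType) (V W : lmodType F) (N : nat)
    (f g : tens V N -> W) : linear f -> linear g ->
  (forall k v, f (tmon v k) = g (tmon v k)) -> f =1 g.
Proof.
move=> fL gL fg x; pose f' := GRing.isLinear.Build F _ _ _ f fL.
pose g' := GRing.isLinear.Build F _ _ _ g gL.
pose fl : {linear _ -> _} := HB.pack f f'.
pose gl : {linear _ -> _} := HB.pack g g'.
rewrite [x]tensE -[f]/(fl : _ -> _) -[g]/(gl : _ -> _) !raddf_sum.
by apply: eq_bigr => k _; apply: fg.
Qed.

Section Laurent.
Variables (F : fieldType) (N : nat).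

Definition laurent : Type := tens F^o N.

HB.instance Definition _ := GRing.Lmodule.on laurent.

Definition laurent_one : laurent := tmon (1 : F^o) 0.

Definition laurent_mul (f g : laurent) : laurent :=
  \sum_(k <- tsupp f) \sum_(l <- tsupp g) tmon (tcoef f k * tcoef g l : F^o) (k + l).

Let mulU_linear (a : F) (k l : 'cV[int]_N) :
  linear (fun b : F^o => tmon (a * b : F^o) (k + l) : laurent).
Proof.
move=> c u v; rewrite -tmon_linear; congr (tmon _ _).
by rewrite mulrDr mulrCA.
Qed.

Let mulr_linear f : linear (laurent_mul f).
Proof.
move=> a g h; rewrite /laurent_mul scaler_sumr -big_split /=.
by apply: eq_bigr => k _; rewrite (tens_ext_linear (mulU_linear (tcoef f k) k)).
Qed.

Let mulrU (f : laurent) b l :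
  laurent_mul f (tmon b l) = \sum_(k <- tsupp f) tmon (tcoef f k * b : F^o) (k + l).
Proof.
by apply: eq_bigr => k _; rewrite (tens_extU (mulU_linear (tcoef f k) k)).
Qed.

Let mull_linear g : linear (laurent_mul^~ g).
Proof.
apply: (@tens_ext_linear F F^o laurent N
  (fun k a => \sum_(l <- tsupp g) tmon (a * tcoef g l : F^o) (k + l))) => k c u v.
rewrite scaler_sumr -big_split /=; apply: eq_bigr => l _.
rewrite -tmon_linear; congr (tmon _ _).
by rewrite mulrDl -mulrA.
Qed.

Lemma laurent_mulUU a b (k l : 'cV[int]_N) :
  laurent_mul (tmon a k) (tmon b l) = tmon (a * b : F^o) (k + l).
Proof.
rewrite mulrU (@tens_extU F F^o laurent N (fun k a => tmon (a * b : F^o) (k + l)))//.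
move=> j c u v; rewrite -tmon_linear; congr (tmon _ _).
by rewrite mulrDl -mulrA.
Qed.

Let id_linear : linear (@id laurent). Proof. by []. Qed.

Fact laurent_mulC : commutative laurent_mul.
Proof.
move=> f g; apply: (tens_linear_eq (mulr_linear f) (mull_linear f)) => l b.
apply: (tens_linear_eq (mull_linear _) (mulr_linear _)) => k a.
by rewrite !laurent_mulUU mulrC addrC.
Qed.

Fact laurent_mul1 : left_id laurent_one laurent_mul.
Proof.
apply: (tens_linear_eq (mulr_linear _) id_linear) => k a.
by rewrite laurent_mulUU mul1r add0r.
Qed.

Fact laurent_mulDl : left_distributive laurent_mul +%R.
Proof. by move=> f g h; rewrite -[f]scale1r mull_linear !scale1r. Qed.

Fact laurent_mulA : associative laurent_mul.
Proof.
move=> f g h.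
apply: (@tens_linear_eq _ _ _ _ (fun h => laurent_mul f (laurent_mul g h))
  (laurent_mul (laurent_mul f g))) => [a x y|//|m c].
  by rewrite 2!mulr_linear.
apply: (@tens_linear_eq _ _ _ _ (fun g => laurent_mul f (laurent_mul g _))
  (fun g => laurent_mul (laurent_mul f g) _)) => [a x y|a x y|l b].
- by rewrite mull_linear mulr_linear.
- by rewrite mulr_linear mull_linear.
apply: (@tens_linear_eq _ _ _ _ (fun f => laurent_mul f _)
  (fun f => laurent_mul (laurent_mul f _) _)) => [//|a x y|k a].
  by rewrite 2!mull_linear.
by rewrite !laurent_mulUU mulrA addrA.
Qed.

Fact laurent_one_neq0 : laurent_one != 0.
Proof.
apply/eqP => /(congr1 (fun f : laurent => tcoef f 0)) /eqP.
by rewrite tcoef_mon eqxx tcoef_fs0 oner_eq0.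
Qed.

HB.instance Definition _ := GRing.Zmodule_isComNzRing.Build laurent
  laurent_mulA laurent_mulC laurent_mul1 laurent_mulDl laurent_one_neq0.

Fact laurent_scaleAl (a : F) (f g : laurent) : a *: (f * g) = a *: f * g.
Proof.
have /= := mull_linear g a f 0.
by rewrite -![laurent_mul _ g]/(_ * g) mul0r !addr0.
Qed.

HB.instance Definition _ :=
  GRing.Lmodule_isLalgebra.Build F laurent laurent_scaleAl.
HB.instance Definition _ := GRing.Lalgebra_isComAlgebra.Build F laurent.

Definition tpow (k : 'cV[int]_N) : laurent := tmon (1 : F^o) k.

Lemma tpowM k l : tpow k * tpow l = tpow (k + l).
Proof. by rewrite -[LHS]/(laurent_mul _ _) laurent_mulUU mulr1. Qed.

Lemma tensUE (a : F) (k : 'cV[int]_N) : tmon (a : F^o) k = a *: tpow k.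
Proof.
apply/tensP => l; rewrite tcoefZ !tcoef_mon.
by case: eqP => _; rewrite ?scaler0 // [RHS]mulr1.
Qed.

Lemma laurent_linear_eq (W : lmodType F) (f g : laurent -> W) :
  linear f -> linear g -> (forall k, f (tpow k) = g (tpow k)) -> f =1 g.
Proof.
move=> fL gL fg; apply: (tens_linear_eq fL gL) => k a.
rewrite tensUE (GRing.scalable_linear fL) (GRing.scalable_linear gL).
by rewrite fg.
Qed.

End Laurent.

Section Der.
Variables (F : fieldType) (A : comAlgType F).

Definition derivation : {pred A -> A} :=
  [pred d : A -> A |
    `[< linear d /\ forall f g, d (f * g) = d f * g + f * d g >]].

Record Der : Type := MkDer { der_fun :> A -> A; _ : der_fun \in derivation }.

HB.instance Definition _ := [isSub for der_fun].
HB.instance Definition _ := [Choice of Der by <:].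

Fact derivation_submod : submod_closed derivation.
Proof.
have z f : (0 : A -> A) f = 0 by [].
split.
  by apply/asboolP; split=> [a u v|f g]; rewrite !z ?scaler0 ?mul0r ?mulr0 addr0.
move=> a d e /asboolP[dL dM] /asboolP[eL eM]; apply/asboolP.
split=> [b u v|f g]; rewrite !fctE.
  by rewrite dL eL !scalerDr addrACA !scalerA [a * b]mulrC.
by rewrite dM eM scalerDr addrACA mulrDl mulrDr -scalerAl -scalerAr.
Qed.

HB.instance Definition _ := GRing.isSubmodClosed.Build F (A -> A) derivation
  derivation_submod.
HB.instance Definition _ := [SubChoice_isSubLmodule of Der by <:].

Lemma der_linear (d : Der) : linear d.
Proof. by have /asboolP[] := valP d. Qed.

Lemma derM (d : Der) f g : d (f * g) = d f * g + f * d g.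
Proof. by have /asboolP[_ ->] := valP d. Qed.

HB.instance Definition _ (d : Der) :=
  GRing.isLinear.Build F A A _ d (der_linear d).

Fact der_bracket_proof (d e : Der) :
  (fun f => d (e f) - e (d f)) \in derivation.
Proof.
apply/asboolP; split=> [a u v|f g].
  by rewrite !linearP /= scalerDr addrACA.
by rewrite !derM !linearD /= !derM; ring.
Qed.

Definition der_bracket (d e : Der) : Der := MkDer (der_bracket_proof d e).

End Der.

Arguments derivation {F} A.

Section Witt.
Variables (F : fieldType) (N : nat).

Definition dot (u v : 'cV[F]_N) : F := (u^T *m v) 0 0.

Definition cvF (k : 'cV[int]_N) : 'cV[F]_N := map_mx intr k.

(* t_i d/dt_i *)
Definition euler (i : 'I_N) (f : laurent F N) : laurent F N :=
  \sum_(k <- tsupp f) tmon ((k i 0)%:~R * tcoef f k) k.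

Definition D_fun (u : 'cV[F]_N) (r : 'cV[int]_N) (f : laurent F N) :
    laurent F N :=
  \sum_(i < N) u i 0 *: (tpow F r * euler i f).

Lemma euler_linear i : linear (euler i).
Proof.
apply: (@tens_ext_linear F F^o (laurent F N) N
  (fun k a => tmon ((k i 0)%:~R * a : F^o) k)) => k a u v.
by rewrite -tmon_linear mulrDr mulrCA.
Qed.

Lemma eulerU i a k : euler i (tmon a k) = tmon ((k i 0)%:~R * a : F^o) k.
Proof.
apply: (@tens_extU F F^o (laurent F N) N
  (fun k a => tmon ((k i 0)%:~R * a : F^o) k)) => l b u v.
by rewrite -tmon_linear mulrDr mulrCA.
Qed.

Lemma D_fun_linear u r : linear (D_fun u r).
Proof.
move=> a f g; rewrite /D_fun scaler_sumr -big_split; apply: eq_bigr => i _ /=.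
by rewrite euler_linear mulrDr scalerDr -scalerAr !scalerA mulrC.
Qed.

Lemma dotE (u v : 'cV[F]_N) : dot u v = \sum_i u i 0 * v i 0.
Proof. by rewrite /dot mxE; apply: eq_bigr => i _; rewrite mxE. Qed.

Lemma D_funE u r k : D_fun u r (tpow F k) = dot u (cvF k) *: tpow F (k + r).
Proof.
rewrite dotE scaler_suml; apply: eq_bigr => i _.
by rewrite eulerU mulr1 tensUE -scalerAr tpowM scalerA mxE addrC.
Qed.

Lemma D_fun_leibniz u r (f g : laurent F N) :
  D_fun u r (f * g) = D_fun u r f * g + f * D_fun u r g.
Proof.
have DL := D_fun_linear u r.
have M1 (h : laurent F N) : linear (fun f : laurent F N => f * h).
  by move=> a x y; rewrite mulrDl scalerAl.
have M2 (h : laurent F N) : linear (fun f : laurent F N => h * f).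
  by move=> a x y; rewrite mulrDr scalerAr.
pose lhs (f g : laurent F N) := D_fun u r (f * g).
pose rhs (f g : laurent F N) := D_fun u r f * g + f * D_fun u r g.
have lhsL1 h : linear (lhs^~ h) by move=> a x y; rewrite /lhs M1 DL.
have lhsL2 h : linear (lhs h) by move=> a x y; rewrite /lhs M2 DL.
have rhsL1 h : linear (rhs^~ h).
  by move=> a x y; rewrite /rhs DL !M1 scalerDr addrACA.
have rhsL2 h : linear (rhs h).
  by move=> a x y; rewrite /rhs DL !M2 scalerDr addrACA.
rewrite -/(lhs f g) -/(rhs f g).
apply: (laurent_linear_eq (lhsL1 g) (rhsL1 g)) => k.
apply: (laurent_linear_eq (lhsL2 _) (rhsL2 _)) => l.
rewrite /lhs /rhs tpowM !D_funE -scalerAl -scalerAr !tpowM.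
have -> : k + r + l = k + l + r by rewrite addrAC.
rewrite addrA -scalerDl; congr (_ *: _).
by rewrite !dotE -big_split; apply: eq_bigr => i _; rewrite !mxE rmorphD mulrDr.
Qed.

Fact D_proof u r : D_fun u r \in derivation (laurent F N).
Proof.
by apply/asboolP; split; [exact: D_fun_linear | exact: D_fun_leibniz].
Qed.

Definition D (u : 'cV[F]_N) (r : 'cV[int]_N) : Der (laurent F N) :=
  MkDer (D_proof u r).

Lemma DE u r k : D u r (tpow F k) = dot u (cvF k) *: tpow F (k + r).
Proof. exact: D_funE. Qed.

End Witt.

Section TensorModule.
Variables (F : fieldType) (N : nat).

Definition evec (i : 'I_N) : 'cV[int]_N := delta_mx i 0.

(* Every derivation d of A_N is sum_r D(u_r, r) with t_i^-1 d(t_i) =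
   sum_r (u_r)_i t^r; see [derE]. *)
Definition W_coef (d : Der (laurent F N)) (r : 'cV[int]_N) : 'cV[F]_N :=
  \col_i tcoef (d (tpow F (evec i))) (r + evec i).

Definition W_supp (d : Der (laurent F N)) : {fset 'cV[int]_N} :=
  [fset s - evec i | i in 'I_N, s in tsupp (d (tpow F (evec i)))].

(* F^beta(V), on all of Der(A_N) by linear extension of the formula for D(u, r);
   the values on generators are given by [F_act_D]. *)
Definition F_act (V : lmodType F) (beta : 'cV[F]_N) (rho : 'M[F]_N -> V -> V)
    (d : Der (laurent F N)) (x : tens V N) : tens V N :=
  \sum_(k <- tsupp x) \sum_(r <- W_supp d)
    let u := W_coef d r in
    tmon (dot u (cvF F k + beta) *: tcoef x k
          + rho (cvF F r *m u^T) (tcoef x k)) (k + r).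

Lemma W_suppP (d : Der (laurent F N)) r i :
  tcoef (d (tpow F (evec i))) (r + evec i) != 0 -> r \in W_supp d.
Proof.
move=> h; apply/imfset2P; exists i => //; exists (r + evec i).
  by rewrite mem_finsupp.
by rewrite addrK.
Qed.

Lemma W_coef_dflt (d : Der (laurent F N)) r : r \notin W_supp d -> W_coef d r = 0.
Proof.
move=> rd; apply/colP => i; rewrite !mxE; apply/eqP.
by apply: contraNT rd; apply: W_suppP.
Qed.

Lemma D_tvar u r i : D u r (tpow F (evec i)) = u i 0 *: tpow F (evec i + r).
Proof.
rewrite DE dotE (bigD1 i) //= big1 => [|j ji].
  by rewrite !mxE !eqxx mulr1 addr0.
by rewrite !mxE (negPf ji) mulr0.
Qed.

Lemma W_coefD (u : 'cV[F]_N) r s :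
  W_coef (D u r) s = if s == r then u else 0.
Proof.
apply/colP => i; rewrite mxE D_tvar tcoefZ tcoef_mon addrC (inj_eq (addrI _)).
by case: eqP => _; [rewrite [LHS]mulr1 | rewrite scaler0 mxE].
Qed.

Lemma W_suppD u r : W_supp (D u r) `<=` [fset r].
Proof.
apply/fsubsetP => s /imfset2P[i _ [l]]; rewrite mem_finsupp D_tvar => h {s}->.
rewrite in_fset1; apply: contraR h => h.
have := tcoefZ (u i 0) (tpow F (evec i + r)) l; rewrite /tcoef => ->.
rewrite -/(tcoef _ l) tcoef_mon; case: (l =P _) h => [->|]; last by rewrite scaler0 eqxx.
by rewrite [evec i + r]addrC addrK eqxx.
Qed.

Lemma F_act_D (V : lmodType F) beta (rho : 'M[F]_N -> V -> V) u r v k :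
  lie_module (@gl_bracket F N) rho ->
  F_act beta rho (D u r) (tmon v k) =
  tmon (dot u (cvF F k + beta) *: v + rho (cvF F r *m u^T) v) (k + r).
Proof.
case=> rhoL rhoV _.
have rho0 v' : rho 0 v' = 0.
  by have /= := GRing.scalable_linear (rhoL v') 0 0; rewrite !scale0r.
pose phi k v s : tens V N := let w := W_coef (D u r) s in
  tmon (dot w (cvF F k + beta) *: v + rho (cvF F s *m w^T) v) (k + s).
pose psi k v := \sum_(s <- W_supp (D u r)) phi k v s.
have psiL l : linear (psi l).
  move=> a x y; rewrite /psi scaler_sumr -big_split; apply: eq_bigr => s _ /=.
  rewrite /phi /= -tmon_linear; congr (tmon _ _).
  by rewrite rhoV !scalerDr !scalerA [a * _]mulrC addrACA.
rewrite [LHS](tens_extU psiL).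
rewrite /psi (big_fset_incl _ (W_suppD u r)) /= => [|s _ sD].
  by rewrite big_seq_fset1 /phi W_coefD eqxx.
rewrite /phi W_coef_dflt // trmx0 mulmx0 rho0 dotE big1 => [|i _].
  have /= := GRing.scalable_linear (@tmon_linear F V N (k + s)) 0 0.
  by rewrite !scale0r addr0.
by rewrite mxE mul0r.
Qed.

Lemma der_eq0 (d : Der (laurent F N)) :
  (forall i, d (tpow F (evec i)) = 0) -> d = 0.
Proof.
move=> d0.
have dD k l : d (tpow F k) = 0 -> d (tpow F l) = 0 -> d (tpow F (k + l)) = 0.
  by move=> dk dl; rewrite -tpowM derM dk dl mul0r mulr0 addr0.
have d1 : d (tpow F 0) = 0.
  have := derM d 1 1; rewrite mulr1 mulr1 mul1r => /eqP.
  by rewrite -subr_eq0 opprD addNKr oppr_eq0 => /eqP.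
have dN k : d (tpow F k) = 0 -> d (tpow F (- k)) = 0.
  move=> dk; have := derM d (tpow F k) (tpow F (- k)).
  rewrite tpowM addrN d1 dk mul0r add0r => /(congr1 ( *%R (tpow F (- k)))).
  rewrite mulr0 mulrA tpowM addNr => h; rewrite [RHS]h; symmetry; exact: mul1r.
have dM k n : d (tpow F k) = 0 -> d (tpow F (k *+ n)) = 0.
  by move=> dk; elim: n => [|n IH]; rewrite ?mulr0n // mulrS; exact: dD.
have dz k (z : int) : d (tpow F k) = 0 -> d (tpow F (k *~ z)) = 0.
  by move=> dk; case: z => n; [exact: dM | exact/dN/dM].
apply/val_inj/funext/laurent_linear_eq; try exact: der_linear.
move=> k; have -> : k = \sum_i evec i *~ k i 0.
  rewrite -[k]trmxK {1}[k^T]row_sum_delta raddf_sum /=.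
  apply: eq_bigr => i _; rewrite linearZ /= trmx_delta mxE.
  by rewrite -scaler_int intz trmxK.
apply: (@big_ind _ (fun k => d (tpow F k) = 0)) => // i _; exact: dz.
Qed.

Lemma derE (d : Der (laurent F N)) :
  d = \sum_(r <- W_supp d) D (W_coef d r) r.
Proof.
apply/eqP; rewrite -subr_eq0; apply/eqP/der_eq0 => i.
have sumE (s : seq 'cV[int]_N) (f : laurent F N) :
    (\sum_(r <- s) D (W_coef d r) r) f = \sum_(r <- s) D (W_coef d r) r f.
  elim: s => [|r s IH]; rewrite ?big_nil ?big_cons //=.
  by rewrite -IH.
suff E : d (tpow F (evec i)) =
  \sum_(r <- W_supp d) D (W_coef d r) r (tpow F (evec i)).
  pose e := \sum_(r <- W_supp d) D (W_coef d r) r.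
  rewrite -[LHS]/(d (tpow F (evec i)) - e (tpow F (evec i))).
  by rewrite /e sumE E; apply: subrr.
under eq_bigr do rewrite D_tvar mxE -tensUE.
apply/tensP => l; rewrite (big_morph (fun x : laurent F N => tcoef x l)
  (fun x y => tcoefD x y l) (tcoef_fs0 F^o l)).
under eq_bigr do rewrite tcoef_mon addrC.
have [ld|ld] := boolP (l - evec i \in W_supp d).
  rewrite (big_fsetD1 _ ld) /= subrK eqxx big1_fset ?addr0 // => r.
  rewrite in_fsetD1 => /andP[rl _ _].
  by rewrite -subr_eq eq_sym (negPf rl).
have -> : tcoef (d (tpow F (evec i))) l = 0.
  by have /colP/(_ i) := W_coef_dflt ld; rewrite !mxE subrK.
by rewrite big1_fset // => r rd _; case: eqP ld => // ->; rewrite addrK rd.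
Qed.

End TensorModule.

(* Main.v *)
(* Let U be a nonzero submodule.  The D(u, 0) grade it: U = sum_k W_k t^k.
   The coefficient of D(u, r - s) D(w, s) (v t^k) is quadratic in s, and its
   second differences lie in every W_m at once; the intersection of the W_m
   is a gl_N-submodule of V.  Hence either U is everything, or the quadratic
   elements (s x^T)(s w^T) - (x|s) s w^T of U(gl_N) kill W_k, and therefore all
   of V because they span an ad-stable subspace.

   In the latter case the E_ii are commuting idempotents on V, and the identity
   matrix acts by an integer 0 <= k <= N.  The linear maps B : C^N -> V with
   (s x^T) B(s) = (x|s) B(s), i.e. those of the form s |-> s /\ b, carry a
   gl_N-action satisfying the same quadratic relations with k replaced by k - 1.
   Iterating k times gives a nonzero equivariant multilinear map from k-tuples
   of vectors to V.  It is alternating because the E_ii are idempotent, so it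
   induces Lambda^k C^N -> V, which is an isomorphism. *)

Require Import Defs.
From HB Require Import structures.
From mathcomp Require Import all_boot all_order all_algebra.
From mathcomp Require Import fingroup perm finmap.
From mathcomp Require Import boolp functions.
From mathcomp Require Import complex reals.
From mathcomp Require Import ring.

Set Implicit Arguments.
Unset Strict Implicit.
Unset Printing Implicit Defensive.

Import GRing.Theory.
Local Open Scope ring_scope.

(* Linear identities in a module [V] become ring identities in the square-zero
   extension [F (+) V], where [ring] decides them. *)
Section SquareZero.
Variables (F : fieldType) (V : lmodType F).

Definition sqz : Type := (F * V)%type.

HB.instance Definition _ := GRing.Zmodule.on sqz.

Definition sqz_mul (x y : sqz) : sqz := (x.1 * y.1, x.1 *: y.2 + y.1 *: x.2).

Fact sqz_mulA : associative sqz_mul.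
Proof.
move=> x y z; rewrite /sqz_mul /= mulrA; congr (_, _).
by rewrite !scalerDr !scalerA addrA [z.1 * x.1]mulrC [z.1 * y.1]mulrC.
Qed.

Fact sqz_mulC : commutative sqz_mul.
Proof. by move=> x y; rewrite /sqz_mul mulrC addrC. Qed.

Fact sqz_mul1 : left_id ((1, 0) : sqz) sqz_mul.
Proof. by case=> a v; rewrite /sqz_mul /= mul1r scale1r scaler0 addr0. Qed.

Fact sqz_mulDl : left_distributive sqz_mul +%R.
Proof.
move=> x y z; rewrite /sqz_mul /= mulrDl; congr (_, _).
by rewrite scalerDl scalerDr addrACA.
Qed.

Fact sqz_one_neq0 : ((1, 0) : sqz) != 0.
Proof. by apply/eqP => -[/eqP]; rewrite oner_eq0. Qed.

HB.instance Definition _ := GRing.Zmodule_isComNzRing.Build sqz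
  sqz_mulA sqz_mulC sqz_mul1 sqz_mulDl sqz_one_neq0.

Definition sqzs (a : F) : sqz := (a, 0).
Definition sqzv (v : V) : sqz := (0, v).

Lemma sqzv_inj : injective sqzv. Proof. by move=> u v []. Qed.

Fact sqzvD : {morph sqzv : u v / u + v}.
Proof. by move=> u v; congr (_, _); rewrite addr0. Qed.

Fact sqzvN : {morph sqzv : u / - u}.
Proof. by move=> u; congr (_, _); rewrite oppr0. Qed.

Fact sqzv0 : sqzv 0 = 0. Proof. by []. Qed.

Fact sqzvZ a u : sqzv (a *: u) = sqzs a * sqzv u.
Proof. by congr (_, _); rewrite /= ?mulr0 // scale0r addr0. Qed.

Fact sqzsD : {morph sqzs : u v / u + v}.
Proof. by move=> u v; congr (_, _); rewrite addr0. Qed.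

Fact sqzsN : {morph sqzs : u / - u}.
Proof. by move=> u; congr (_, _); rewrite oppr0. Qed.

Fact sqzsM : {morph sqzs : u v / u * v}.
Proof. by move=> u v; congr (_, _); rewrite !scaler0 addr0. Qed.

Fact sqzs0 : sqzs 0 = 0. Proof. by []. Qed.

Fact sqzs1 : sqzs 1 = 1. Proof. by []. Qed.

Definition sqzE := (sqzvD, sqzvN, sqzvZ, sqzv0, sqzsD, sqzsN, sqzsM,
  sqzs0, sqzs1).

End SquareZero.

Ltac module := apply: sqzv_inj; rewrite ?sqzE; ring.


(** * The bilinear form and rank-one matrices *)

Section Outer.
Variables (F : fieldType) (N : nat).
Implicit Types (s x u w : 'cV[F]_N) (A : 'M[F]_N).

Lemma dotC u w : dot u w = dot w u.
Proof. by rewrite !dotE; apply: eq_bigr => i _; rewrite mulrC. Qed.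

Lemma dotP a u w x : dot x (a *: u + w) = a * dot x u + dot x w.
Proof. by rewrite /dot linearP !mxE. Qed.

Lemma dotD u w x : dot x (u + w) = dot x u + dot x w.
Proof. by have := dotP 1 u w x; rewrite scale1r mul1r. Qed.

Lemma dotZ a u x : dot x (a *: u) = a * dot x u.
Proof. by rewrite /dot -scalemxAr mxE. Qed.

Lemma dot0 x : dot x 0 = 0 :> F.
Proof. by rewrite /dot mulmx0 mxE. Qed.

Lemma dotN u x : dot x (- u) = - dot x u.
Proof. by rewrite -scaleN1r dotZ mulN1r. Qed.

Lemma dotZl a u x : dot (a *: u) x = a * dot u x.
Proof. by rewrite !(dotC _ x) dotZ. Qed.

Lemma dotBl u w x : dot (u - w) x = dot u x - dot w x.
Proof. by rewrite !(dotC _ x) dotD dotN. Qed.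

Lemma dot_trmx A x u : dot (A^T *m x) u = dot x (A *m u).
Proof. by rewrite /dot trmx_mul trmxK mulmxA. Qed.

Lemma outer_mul s x u w :
  s *m x^T *m (u *m w^T) = dot x u *: (s *m w^T).
Proof.
rewrite mulmxA -[s *m x^T *m u]mulmxA [x^T *m u]mx11_scalar -/(dot x u).
by rewrite mul_mx_scalar scalemxAl.
Qed.

Lemma outer_mulv s x u : s *m x^T *m u = dot x u *: s.
Proof.
rewrite -[s *m x^T *m u]mulmxA [x^T *m u]mx11_scalar -/(dot x u).
by rewrite mul_mx_scalar.
Qed.

Lemma mul_outer A s x : s *m x^T *m A = s *m (A^T *m x)^T.
Proof. by rewrite trmx_mul trmxK mulmxA. Qed.

Lemma cV_sum_delta u : u = \sum_i u i 0 *: delta_mx i 0.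
Proof.
apply/colP => i; rewrite summxE (bigD1 i) //= big1 => [|j ji].
  by rewrite !mxE !eqxx mulr1 addr0.
by rewrite !mxE eq_sym (negPf ji) mulr0.
Qed.

Lemma delta_outer (i j : 'I_N) :
  delta_mx i j =
    (delta_mx i 0 : 'cV_N) *m (delta_mx j 0 : 'cV_N)^T :> 'M[F]_N.
Proof. by rewrite trmx_delta mul_delta_mx. Qed.

Lemma dot_delta (i j : 'I_N) :
  dot (delta_mx i 0 : 'cV[F]_N) (delta_mx j 0) = (i == j)%:R.
Proof.
rewrite /dot trmx_delta mul_delta_mx_cond.
by case: eqP => _; rewrite !mxE ?eqxx.
Qed.

End Outer.

(* Representations are kept relative to a subspace [K] of the ambient module, so
   that subspaces of function spaces need not be turned into types. *)
Section RepOn.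
Variables (F : fieldType) (N : nat).
Implicit Types (s x : 'cV[F]_N) (A B : 'M[F]_N).

Record rep_on (H : lmodType F) (rho : 'M[F]_N -> H -> H) (K : H -> Prop) :
  Prop := RepOn {
  repK0 : K 0;
  repKP : forall a u v, K u -> K v -> K (a *: u + v);
  repK : forall A v, K v -> K (rho A v);
  repPr : forall A, linear (rho A);
  repPl : forall v, K v -> linear (rho^~ v);
  repC : forall A B v, K v -> rho A (rho B v) =
           rho B (rho A v) + rho (A *m B) v - rho (B *m A) v }.

Section Theory.
Variables (H : lmodType F) (rho : 'M[F]_N -> H -> H) (K : H -> Prop).
Hypothesis rhoK : rep_on rho K.
Implicit Types (v : H).

Lemma rep0r A : rho A 0 = 0.
Proof. by have := repPr rhoK A (-1) 0 0; rewrite !scaleN1r !addNr. Qed.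

Lemma repDr A u v : rho A (u + v) = rho A u + rho A v.
Proof. by have := repPr rhoK A 1 u v; rewrite !scale1r. Qed.

Lemma repZr A a v : rho A (a *: v) = a *: rho A v.
Proof. by have := repPr rhoK A a v 0; rewrite rep0r !addr0. Qed.

Lemma repBr A u v : rho A (u - v) = rho A u - rho A v.
Proof. by rewrite -scaleN1r repDr repZr scaleN1r. Qed.

Lemma rep_sumr A I (r : seq I) (P : pred I) (f : I -> H) :
  rho A (\sum_(i <- r | P i) f i) = \sum_(i <- r | P i) rho A (f i).
Proof. exact: (big_morph _ (repDr A) (rep0r A)). Qed.

Lemma rep0l v : K v -> rho 0 v = 0.
Proof.
by move=> Kv; have := repPl rhoK Kv (-1) 0 0; rewrite !scaleN1r !addNr.
Qed.

Lemma repDl A B v : K v -> rho (A + B) v = rho A v + rho B v.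
Proof. by move=> Kv; have := repPl rhoK Kv 1 A B; rewrite !scale1r. Qed.

Lemma repZl a A v : K v -> rho (a *: A) v = a *: rho A v.
Proof. by move=> Kv; have := repPl rhoK Kv a A 0; rewrite rep0l // !addr0. Qed.

Lemma repBl A B v : K v -> rho (A - B) v = rho A v - rho B v.
Proof. by move=> Kv; rewrite repDl // -[- B]scaleN1r repZl // scaleN1r. Qed.

Lemma rep_suml I (r : seq I) (P : pred I) (f : I -> 'M[F]_N) v : K v ->
  rho (\sum_(i <- r | P i) f i) v = \sum_(i <- r | P i) rho (f i) v.
Proof.
move=> Kv; apply: (big_morph (rho^~ v) _ (rep0l Kv)) => A B; exact: repDl.
Qed.

Lemma repKD u v : K u -> K v -> K (u + v).
Proof. by move=> Ku; rewrite -[u in u + v]scale1r; exact: (repKP rhoK). Qed.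

Lemma repKZ a u : K u -> K (a *: u).
Proof.
move=> Ku; rewrite -[_ *: _]addr0.
exact: (repKP rhoK _ Ku (repK0 rhoK)).
Qed.

Lemma repKB u v : K u -> K v -> K (u - v).
Proof. by move=> Ku Kv; rewrite -scaleN1r; apply/repKD/repKZ. Qed.

Lemma rep_eq0_delta v : K v -> (forall i j, rho (delta_mx i j) v = 0) ->
  forall A, rho A v = 0.
Proof.
move=> Kv h A; rewrite [A]matrix_sum_delta rep_suml // big1 // => i _.
by rewrite rep_suml // big1 // => j _; rewrite repZl // h scaler0.
Qed.

(* [A . B] is the action on [Hom(C^N, H)]; [wedge_like B] says in coordinates
   that [B] has the form [s |-> s /\ b]. *)
Definition hom_act A (B : 'cV[F]_N -> H) : 'cV[F]_N -> H :=
  fun u => rho A (B u) - B (A *m u).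

Definition wedge_like (B : 'cV[F]_N -> H) :=
  forall s x, rho (s *m x^T) (B s) = dot x s *: B s.

(** Polarization: [wedge_like] is quadratic in its vector, and this is its expansion at [s + u]. *)
Lemma wedge_like_pol (B : 'cV[F]_N -> H) : linear B -> (forall u, K (B u)) ->
  wedge_like B -> forall s u x,
  rho (s *m x^T) (B u) = dot x s *: B u + dot x u *: B s - rho (u *m x^T) (B s).
Proof.
move=> BL KB BR s u x.
have BD a b : B (a + b) = B a + B b by have := BL 1 a b; rewrite !scale1r.
have := BR (s + u) x.
rewrite mulmxDl BD repDl ?repDr ?BR; last by apply: repKD; apply: KB.
rewrite dotD => /eqP; rewrite -subr_eq0 => /eqP E; apply/eqP.
rewrite -subr_eq0 -E; apply/eqP; module.
Qed.

(** The commutator of [A] with [s x^T] and the polarized relation at [s], [A s] both produce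
    [rho (A s x^T) (B s)], with opposite signs. *)
Lemma hom_act_wedge_like A (B : 'cV[F]_N -> H) :
  linear B -> (forall u, K (B u)) -> wedge_like B -> wedge_like (hom_act A B).
Proof.
move=> BL KB BR s x.
rewrite /hom_act repBr (wedge_like_pol BL KB BR s (A *m s)).
rewrite (repC rhoK) // BR repZr mul_outer mulmxA BR dot_trmx; module.
Qed.

End Theory.
End RepOn.

(** * Multilinear and equivariant maps in the columns of a matrix *)

Section ColumnMaps.
Variables (F : fieldType) (N : nat).

Definition setcol k (M : 'M[F]_(N, k)) (j : 'I_k) (u : 'cV[F]_N) :=
  \matrix_(a, b) (if b == j then u a 0 else M a b).

Definition multilinear (H : lmodType F) k (Phi : 'M[F]_(N, k) -> H) :=
  forall M j, linear (fun u => Phi (setcol M j u)).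

Definition equivariant (H : lmodType F) (rho : 'M[F]_N -> H -> H) k
    (Phi : 'M[F]_(N, k) -> H) :=
  forall A M, rho A (Phi M) = \sum_(j < k) Phi (act_on_col A j M).

Lemma setcol_col k (M : 'M[F]_(N, k)) j : setcol M j (col j M) = M.
Proof. by apply/matrixP => a b; rewrite !mxE; case: eqP => // ->. Qed.

End ColumnMaps.

(* [ext_type k] captures what is used of a multiple of [Lambda^k]. *)
Section ExteriorType.
Variables (F : fieldType) (N : nat).
Hypothesis charF : [pchar F] =i pred0.
Implicit Types (s x w : 'cV[F]_N) (A : 'M[F]_N).

Record ext_type (k : nat) (H : lmodType F) (rho : 'M[F]_N -> H -> H)
    (K : H -> Prop) : Prop := ExtType {
  ext_rep :> rep_on rho K;
  ext_wedge : forall w v, K v -> wedge_like rho (fun s => rho (s *m w^T) v);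
  ext_deg : forall v, K v -> rho 1%:M v = k%:R *: v }.

(** If [B] is [u |-> u /\ b], then [hom_act A B] is [u |-> u /\ A b], so the maps [B] behave like
    the elements [b] one degree lower. The degree drops because [hom_act 1%:M] subtracts [B u]
    itself. *)
Lemma ext_type_hom k (H : lmodType F) (rho : 'M[F]_N -> H -> H)
    (K : H -> Prop) :
  ext_type k.+1 rho K ->
  ext_type k (hom_act rho)
    (fun B => [/\ linear B, forall u, K (B u) & wedge_like rho B]).
Proof.
case=> rK T deg; split.
- split.
  + split=> [a u v||s x]; rewrite ?fctE.
    * by rewrite scaler0 addr0.
    * by move=> u; exact: (repK0 rK).
    * by rewrite (rep0r rK) scaler0.
  + move=> a B C [BL KB BR] [CL KC CR]; split=> [b u v|u|s x]; rewrite !fctE.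
    * by rewrite BL CL; module.
    * exact: (repKP rK).
    * by rewrite (repPr rK) BR CR; module.
  + move=> A B [BL KB BR]; split=> [a u v|u|].
    * by rewrite /hom_act linearP !BL (repPr rK); module.
    * by apply: (repKB rK); [apply: (repK rK) |].
    * exact: (hom_act_wedge_like rK).
  + move=> A a B C; apply/funext => u; rewrite /hom_act !fctE (repPr rK).
    by module.
  + move=> B [BL KB BR] a A C; apply/funext => u; rewrite /hom_act !fctE.
    rewrite (repPl rK) // mulmxDl -scalemxAl BL; module.
  + move=> A C B [BL KB BR]; apply/funext => u; rewrite /hom_act !fctE.
    rewrite !(repBr rK) (repC rK A C) // !mulmxA; module.
- move=> w B [BL KB BR] s x; apply/funext => u; rewrite /hom_act !fctE.
  have BZ a v : B (a *: v) = a *: B v.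
    have B0 : B 0 = 0.
      by have := BL (-1) 0 0; rewrite !scaleN1r !addNr.
    by have := BL a v 0; rewrite B0 !addr0.
  rewrite !outer_mulv !dotZ !BZ !(repBr rK) (T w _ (KB u)).
  by rewrite !(repZr rK) !BR; module.
- move=> B [BL KB BR]; apply/funext => u; rewrite /hom_act !fctE mul1mx deg //.
  rewrite -natr1; module.
Qed.

Section Eigen.
Variables (k : nat) (H : lmodType F) (rho : 'M[F]_N -> H -> H) (K : H -> Prop).
Hypothesis rK : rep_on rho K.
Hypothesis T : forall w v, K v -> wedge_like rho (fun s => rho (s *m w^T) v).

(** The wedge relation at [s = x = e_i]; for [j = i] it makes [E_ii] idempotent. *)
Lemma ext_idem (i j : 'I_N) v : K v ->
  rho (delta_mx i i) (rho (delta_mx i j) v) = rho (delta_mx i j) v.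
Proof.
move=> Kv; rewrite [delta_mx i i]delta_outer [delta_mx i j]delta_outer.
by rewrite T // dot_delta eqxx scale1r.
Qed.

(** The idempotents [E_jj] commute, so [v] can be adjusted one index at a time: if [E_jj] kills the
    current [w], keep [w] with eigenvalue 0, otherwise pass to [E_jj w] with eigenvalue 1. The last
    clause records that eigenvalues already present at [v] survive. *)
Lemma joint_eigenvector v : K v -> v <> 0 ->
  exists (w : H) (c : 'I_N -> bool), [/\ K w, w <> 0,
    forall i, rho (delta_mx i i) w = (c i)%:R *: w &
    forall i a, rho (delta_mx i i) v = a *: v ->
      rho (delta_mx i i) w = a *: w].
Proof.
move=> Kv v0.
suff [w [c [Kw w0 ew ev]]] : exists (w : H) (c : 'I_N -> bool), [/\ K w, w <> 0,
    forall i, i \in enum 'I_N -> rho (delta_mx i i) w = (c i)%:R *: w &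
    forall i a, rho (delta_mx i i) v = a *: v ->
      rho (delta_mx i i) w = a *: w].
  by exists w, c; split=> // i; apply: ew; rewrite mem_enum.
elim: (enum _) => [|j r [w [c [Kw w0 ew ev]]]]; first by exists v, (fun=> true).
have C i l u : K u -> rho (delta_mx i i) (rho (delta_mx l l) u) =
    rho (delta_mx l l) (rho (delta_mx i i) u).
  move=> Ku; rewrite (repC rK) // !mul_delta_mx_cond [l == i]eq_sym.
  by case: eqP => [->|_]; rewrite ?mulr1n ?mulr0n addrK.
have tr i a (u : H) : K u -> rho (delta_mx i i) u = a *: u ->
    rho (delta_mx i i) (rho (delta_mx j j) u) = a *: rho (delta_mx j j) u.
  by move=> Ku E; rewrite C // E (repZr rK).
pose c' b i := if i == j then b else c i.
have [E|E] := pselect (rho (delta_mx j j) w = 0).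
  exists w, (c' false); split=> // i; rewrite /c' inE.
  by have [-> _|ij /= ir] := eqVneq i j; [rewrite scale0r|apply: ew].
exists (rho (delta_mx j j) w), (c' true); split=> // [|i|i a /ev /tr -> //].
  exact: (repK rK).
rewrite /c' inE; have [-> _|ij /= ir] := eqVneq i j.
  by rewrite scale1r ext_idem.
by apply: tr => //; apply: ew.
Qed.

Lemma eigen_deg v (c : 'I_N -> bool) : K v ->
  (forall i, rho (delta_mx i i) v = (c i)%:R *: v) ->
  rho 1%:M v = (\sum_i c i)%:R *: v.
Proof.
move=> Kv cv; rewrite mx1_sum_delta (rep_suml rK) //.
by rewrite (eq_bigr _ (fun i _ => cv i)) -scaler_suml natr_sum.
Qed.

End Eigen.

(** If [E_ii u] were nonzero, a joint eigenvector built from it would have eigenvalue 1 at [i],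
    whereas its eigenvalues are 0 or 1 and add up to the degree 0. Then [E_ij = E_ii E_ij] vanishes
    as well. *)
Lemma ext_type0_trivial (H : lmodType F) (rho : 'M[F]_N -> H -> H)
    (K : H -> Prop) v A : ext_type 0 rho K -> K v -> rho A v = 0.
Proof.
case=> rK T deg Kv; apply: (rep_eq0_delta rK Kv).
have d0 i u : K u -> rho (delta_mx i i) u = 0.
  move=> Ku; apply: contrapT => u0.
  have [|w [c [Kw w0 cw /(_ i 1)]]] := joint_eigenvector rK T _ u0.
    exact: (repK rK).
  rewrite scale1r (ext_idem T) // => /(_ erefl) iw.
  have := deg _ Kw; rewrite (eigen_deg rK Kw cw) scale0r => /eqP.
  rewrite scaler_eq0 => /orP[|/eqP //].
  rewrite ((pcharf0P _).1 charF).
  rewrite sum_nat_eq0 => /forallP/(_ i)/implyP/(_ isT) /eqP ci.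
  by apply: w0; rewrite -[w]scale1r -iw cw ci scale0r.
by move=> i j; rewrite -(ext_idem T) // d0 //; apply: (repK rK).
Qed.

(** Induction on [k]: a constant map serves in degree 0, and otherwise the map obtained for the
    [Hom] space takes the last [k] columns to a function whose argument becomes the first column. *)
Lemma ext_lift k (H : lmodType F) (rho : 'M[F]_N -> H -> H) (K : H -> Prop) v :
  ext_type k rho K -> K v -> v <> 0 ->
  exists Phi : 'M[F]_(N, k) -> H, [/\ multilinear Phi, equivariant rho Phi,
    forall M, K (Phi M) & exists M, Phi M <> 0].
Proof.
elim: k H rho K v => [|k IH] H rho K v Hk Kv v0.
  exists (fun=> v); split=> // [? []//|A M|]; last by exists 0.
  by rewrite big_ord0 (ext_type0_trivial A Hk Kv).
have [rK T deg] := Hk.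
(* If all these functions vanished, every matrix unit would kill [v], but the identity acts by the
   nonzero scalar [k.+1]. *)
have [w w0] : exists w, (fun s => rho (s *m w^T) v) <> (0 : 'cV[F]_N -> H).
  apply: contrapT => /forallNP h.
  have: rho 1%:M v = 0.
    apply: (rep_eq0_delta rK Kv) => i j; rewrite delta_outer.
    by have /contrapT/(congr1 (fun f => f (delta_mx i 0))) := h (delta_mx j 0).
  rewrite deg // => /eqP; rewrite scaler_eq0 ((pcharf0P _).1 charF) /=.
  by move=> /eqP.
have [|Phi [ML EQ KPhi [M M0]]] := IH _ _ _ _ (ext_type_hom Hk) _ w0.
  split=> [a s u|s|]; [| exact: (repK rK) | exact: T].
  by rewrite mulmxDl -scalemxAl (repPl rK).
pose hd (L : 'M[F]_(N, k.+1)) := lsubmx (L : 'M_(N, 1 + k)).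
pose tl (L : 'M[F]_(N, k.+1)) := rsubmx (L : 'M_(N, 1 + k)).
exists (fun L => Phi (tl L) (hd L)); split.
- move=> L j a u w'.
  have [-> | [j' ->]] : j = ord0 \/ exists j', j = lift ord0 j'.
    by case: (unliftP ord0 j) => [j' ->|->]; [right; exists j'|left].
  + have l x : hd (setcol L ord0 x) = x.
      apply/colP => i; rewrite !mxE; case: eqP => // h.
      by case: h; apply/val_inj.
    have r x : tl (setcol L ord0 x) = tl L.
      by apply/matrixP => i b; rewrite !mxE.
    by rewrite !l !r; have [-> _ _] := KPhi (tl L).
  + have l x : hd (setcol L (lift ord0 j') x) = hd L.
      by apply/matrixP => i b; rewrite !mxE ord1.
    have r x : tl (setcol L (lift ord0 j') x) =
        setcol (tl L) j' x.
      by apply/matrixP => i b; rewrite !mxE.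
    by rewrite !l !r ML.
- move=> A L; rewrite big_ord_recl.
  have l0 : hd (act_on_col A ord0 L) = A *m hd L.
    apply/colP => i; rewrite !mxE; case: eqP => [_|[]]; last exact/val_inj.
    by apply: eq_bigr => ? _; rewrite !mxE; congr (_ * L _ _); apply/val_inj.
  have r0 : tl (act_on_col A ord0 L) = tl L.
    by apply/matrixP => i b; rewrite !mxE.
  have l j : hd (act_on_col A (lift ord0 j) L) = hd L.
    by apply/matrixP => i b; rewrite !mxE ord1.
  have r j : tl (act_on_col A (lift ord0 j) L) =
      act_on_col A j (tl L).
    apply/matrixP => i b; rewrite !mxE; congr (if _ then _ else _).
    by apply: eq_bigr => ? _; rewrite !mxE.
  under eq_bigr do rewrite l r.
  (* The term that [hom_act A] subtracts is the one where [A] hits the first column. *)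
  rewrite l0 r0; have /(congr1 (fun f => f (hd L))) := EQ A (tl L).
  rewrite /hom_act fct_sumE => <-; module.
- by move=> L; have [_ + _] := KPhi (tl L); apply.
- apply: contrapT => /forallNP h; apply: M0; apply/funext => u.
  have /contrapT := h (row_mx u M : 'M_(N, 1 + k)).
  by rewrite /tl /hd row_mxKl row_mxKr.
Qed.

End ExteriorType.

(** * Multilinear maps evaluated on columns that are basis vectors *)

Section BasisColumns.
Variables (F : fieldType) (N k : nat).
Implicit Types (h : 'I_k -> 'I_N).

(** Unlike in [ext_basis], indices may repeat or be unordered: replacing a column leaves the
    increasing tuples. *)
Definition ecols h : 'M[F]_(N, k) := colsub h 1%:M.

Definition upd h j i : 'I_k -> 'I_N := fun b => if b == j then i else h b.

Lemma act_on_col_delta (i l : 'I_N) j h :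
  act_on_col (delta_mx i l) j (ecols h) =
  if h j == l then ecols (upd h j i) else setcol (ecols h) j 0.
Proof.
apply/matrixP => a b; rewrite !mxE /upd.
have [-> | bj] := eqVneq b j; last first.
  by case: ifP => _; rewrite !mxE (negPf bj).
rewrite (bigD1 l) //= big1 => [|c cl].
  rewrite !mxE eqxx andbT addr0 [l == _]eq_sym.
  by case: ifP => _; rewrite !mxE eqxx ?mulr1 ?mulr0.
by rewrite !mxE (negPf cl) andbF mul0r.
Qed.

Lemma multilinear0 (H : lmodType F) (Phi : 'M[F]_(N, k) -> H) M j :
  multilinear Phi -> Phi (setcol M j 0) = 0.
Proof. by move=> ML; have := ML M j (-1) 0 0; rewrite !scaleN1r !addNr. Qed.

Lemma multilinear_sum (H : lmodType F) (Phi : 'M[F]_(N, k) -> H) M j I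
    (r : seq I) (a : I -> F) (u : I -> 'cV[F]_N) :
  multilinear Phi -> Phi (setcol M j (\sum_(i <- r) a i *: u i)) =
    \sum_(i <- r) a i *: Phi (setcol M j (u i)).
Proof.
move=> ML; elim: r => [|i r IH]; first by rewrite !big_nil multilinear0.
by rewrite !big_cons ML IH.
Qed.

(** The columns are expanded one at a time; in [gen n], those from index [n] on are already basis
    vectors. *)
Lemma multilinear_eq0 (H : lmodType F) (Phi : 'M[F]_(N, k) -> H) :
  multilinear Phi -> (forall h, Phi (ecols h) = 0) -> forall M, Phi M = 0.
Proof.
move=> ML Phi0 M.
suff gen n : (n <= k)%N -> forall (L : 'M[F]_(N, k)) h,
    (forall j : 'I_k, (n <= j)%N -> col j L = delta_mx (h j) 0) -> Phi L = 0.
  (* An initial [h] is missing only if [k > 0] and [N = 0], and then the matrix has no entries. *)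
  have [h|h] := pselect (exists h : 'I_k -> 'I_N, True).
    case: h => h _; apply: (gen k (leqnn k) M h) => j kj.
    by have := ltn_ord j; rewrite ltnNge kj.
  case: (posnP k) => [k0|k0].
    have f (j : 'I_k) : 'I_N by case: j => j; rewrite k0.
    by case: h; exists f.
  have -> : M = setcol M (Ordinal k0) 0; last exact: multilinear0.
  apply/matrixP => a b; case: h; exists (fun=> a); exact: I.
elim: n => [|n IH] nk L h Lh.
  suff -> : L = ecols h by [].
  apply/matrixP => a b; have /matrixP/(_ a 0) := Lh b (leq0n _).
  by rewrite !mxE andbT.
pose j := Ordinal nk.
rewrite -(setcol_col L j) [col j L]cV_sum_delta multilinear_sum //.
rewrite big1 // => i _.
rewrite (IH (ltnW nk) _ (upd h j i)) ?scaler0 // => b nb.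
have [-> | bj] := eqVneq b j.
  by apply/colP => a; rewrite !mxE /upd !eqxx.
have bn : (n < b)%N.
  by rewrite ltn_neqAle nb eq_sym -(inj_eq val_inj) in bj *; rewrite bj.
apply/colP => a; have /colP/(_ a) := Lh b bn.
by rewrite !mxE /upd (negPf bj).
Qed.

End BasisColumns.

(** * Increasing tuples as subsets, and sorting *)

Section IncreasingTuples.
Variables (N k : nat).
Implicit Types (s t : incr_tuple N k).

Lemma incr_uniq s : uniq (val s).
Proof.
have := valP s; rewrite ltn_sorted_uniq_leq => /andP[].
by rewrite map_inj_uniq //; apply: val_inj.
Qed.

Lemma incr_inj s : injective (tnth (val s)).
Proof. exact/tuple_uniqP/incr_uniq. Qed.

(** Both have [k] distinct entries, hence the same entries, and a strictly increasing list is
    determined by its set of entries. *)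
Lemma incr_subset_eq s t : {subset val s <= val t} -> s = t.
Proof.
move=> st; have [_ E] := uniq_min_size (incr_uniq s) st
  (eq_leq (etrans (size_tuple _) (esym (size_tuple _)))).
apply/val_inj/val_inj/(inj_map val_inj).
apply: (irr_sorted_eq ltn_trans ltnn (valP s) (valP t)) => n.
by apply/mapP/mapP => -[i ii ->]; exists i; rewrite // ?E // -E.
Qed.

Lemma incr_sort (h : 'I_k -> 'I_N) : injective h ->
  exists s (p : 'S_k), forall i, tnth (val s) i = h (p i).
Proof.
move=> hI; pose t := [tuple h i | i < k].
pose r := sort (fun i j : 'I_N => (i <= j)%N) t.
have szr : size r == k by rewrite size_sort size_tuple.
have ur : uniq r by rewrite sort_uniq map_inj_uniq ?enum_uniq.
have sr : sorted ltn (map val (Tuple szr)).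
  rewrite ltn_sorted_uniq_leq map_inj_uniq; last exact: val_inj.
  rewrite ur /= sorted_map; apply: sort_sorted => i j; exact: leq_total.
have /tuple_permP[p E] : perm_eq (Tuple szr) t by rewrite perm_sort.
exists (exist _ (Tuple szr) sr), p => i /=.
have -> : Tuple szr = [tuple tnth t (p i) | i < k] by apply/val_inj.
by rewrite !tnth_mktuple.
Qed.

End IncreasingTuples.

(** * The wedge product given by maximal minors *)

Section Minors.
Variables (F : fieldType) (N k : nat).
Implicit Types (s t : incr_tuple N k) (h : 'I_k -> 'I_N).

Lemma wedge_multilinear : multilinear (@wedge F N k).
Proof.
move=> M j a u w; apply/ffunP => s; rewrite !ffunE.
rewrite -[LHS]det_tr -[\det (rowsub _ (setcol M j u))]det_tr.
rewrite -[\det (rowsub _ (setcol M j w))]det_tr.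
rewrite -[X in _ = _ + X]mul1r; apply: (determinant_multilinear (i0 := j)).
- by apply/rowP => b; rewrite !mxE eqxx mul1r.
- by apply/matrixP => i b; rewrite !mxE eq_sym (negPf (neq_lift j i)).
- by apply/matrixP => i b; rewrite !mxE eq_sym (negPf (neq_lift j i)).
Qed.

Lemma wedge_alt h a b : a != b -> h a = h b -> wedge (ecols F h) = 0.
Proof.
move=> ab hab; apply/ffunP => s; rewrite !ffunE -det_tr.
by apply: (determinant_alternate ab) => i; rewrite !mxE hab.
Qed.

Lemma wedge_swap h a b : a != b ->
  wedge (ecols F (h \o tperm a b)) = - wedge (ecols F h).
Proof.
move=> ab; apply/ffunP => s; rewrite !ffunE.
have -> : rowsub (tnth (val s)) (ecols F (h \o tperm a b)) =
    xcol a b (rowsub (tnth (val s)) (ecols F h)).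
  by apply/matrixP => i j; rewrite !mxE.
by rewrite xcolE det_mulmx det_perm odd_tperm ab mulrN1.
Qed.

(** If [s != t], some entry of [t] is not in [s], and the corresponding row of the minor is zero. *)
Lemma wedge_ext_basis s t : wedge (ext_basis F s) t = (s == t)%:R.
Proof.
rewrite ffunE; have [-> | st] := eqVneq s t.
  rewrite (_ : rowsub _ _ = 1%:M) ?det1 //; apply/matrixP => i j; rewrite !mxE.
  by rewrite (inj_eq (@incr_inj _ _ t)).
have [i is'] : exists i, tnth (val t) i \notin val s.
  apply: contrapT => /forallNP h; case/eqP: st; apply/esym/incr_subset_eq => a.
  by case/tnthP => i ->; apply/negPn/negP; apply: h.
rewrite (expand_det_row _ i) big1 // => j _; rewrite !mxE.
case: eqP is' => [->|]; rewrite ?mul0r //.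
by rewrite mem_tnth.
Qed.

End Minors.

(** * The map from the exterior power induced by [Phi] *)

Section LiftBasis.
Variables (F : fieldType) (N k : nat).
Hypothesis charF : [pchar F] =i pred0.
Variables (V : lmodType F) (rho : 'M[F]_N -> V -> V).
Hypothesis rK : rep_on rho (fun=> True).
Hypothesis T : forall w v, wedge_like rho (fun s => rho (s *m w^T) v).
Variable Phi : 'M[F]_(N, k) -> V.
Hypothesis ML : multilinear Phi.
Hypothesis EQ : equivariant rho Phi.
Implicit Types (h : 'I_k -> 'I_N) (s : incr_tuple N k).

Lemma lift_delta i l h :
  rho (delta_mx i l) (Phi (ecols F h)) =
  \sum_(j | h j == l) Phi (ecols F (upd h j i)).
Proof.
rewrite EQ [RHS]big_mkcond; apply: eq_bigr => j _; rewrite act_on_col_delta.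
by case: ifP => // _; rewrite multilinear0.
Qed.

Lemma upd_id h j : upd h j (h j) = h.
Proof. by apply/funext => b; rewrite /upd; case: eqP => // ->. Qed.

(* [E_ii] is idempotent and acts on [Phi (ecols h)] by the number [p] of columns
   equal to [e_i]: repeated columns are excluded by [p ^ 2 = p]. *)
Lemma lift_alt h a b : a != b -> h a = h b -> Phi (ecols F h) = 0.
Proof.
move=> ab hab; set y := Phi _; pose p := #|[pred j | h j == h a]|.
have Ey : rho (delta_mx (h a) (h a)) y = p%:R *: y.
  rewrite lift_delta (eq_bigr (fun=> y)) => [|j /eqP <-].
  2: by rewrite upd_id.
  by rewrite sumr_const scaler_nat.
have p1 : (1 < p)%N.
  by rewrite /p (cardD1 a) (cardD1 b) !inE eqxx eq_sym ab -hab eqxx.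
have := ext_idem (K := fun=> True) (fun w v _ => T w v) (h a) (h a) (v := y) I.
rewrite Ey (repZr rK) Ey scalerA => /eqP.
rewrite -subr_eq0 -scalerBl scaler_eq0.
case/orP => [|/eqP //].
rewrite -[X in _ - X]mulr1 -mulrBr mulf_eq0 ((pcharf0P _).1 charF).
rewrite -(@natrB _ p 1) ?(ltnW p1) // ((pcharf0P _).1 charF) subn_eq0.
by rewrite leqNgt p1 orbF => /eqP p0; rewrite p0 in p1.
Qed.

(** Put [e_(h b)] in both columns [a] and [b]: the value is 0, and applying the matrix unit at
    [(h a, h b)] gives exactly the two terms for [h] and its swap. *)
Lemma lift_swap h a b : injective h -> a != b ->
  Phi (ecols F (h \o tperm a b)) = - Phi (ecols F h).
Proof.
move=> hI ab; pose g := upd h a (h b).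
have ga : g a = h b by rewrite /g /upd eqxx.
have gb : g b = h b by rewrite /g /upd eq_sym (negPf ab).
have := lift_delta (h a) (h b) g; rewrite (lift_alt ab) ?ga // (rep0r rK).
rewrite (bigD1 a) ?ga //= (bigD1 b) /= ?gb ?eqxx 1?eq_sym //.
rewrite big1 => [|j /andP[/andP[]]]; last first.
  by rewrite /g /upd => /eqP + ja; rewrite (negPf ja) => /hI ->; rewrite eqxx.
have -> : upd g a (h a) = h.
  by apply/funext => c; rewrite /upd /g /upd; case: eqP => // ->.
have -> : upd g b (h a) = h \o tperm a b.
  apply/funext => c; rewrite /upd /g /upd /=; case: tpermP => [->|->|].
  - by rewrite (negPf ab) eqxx.
  - by rewrite eqxx.
  - by move=> /eqP/negPf -> /eqP/negPf ->.
by rewrite addr0 => /esym/eqP; rewrite addrC addr_eq0 => /eqP.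
Qed.

(** An injective [g] is reached from [h] by swaps and replacements of single columns, both
    preserving the vanishing; the induction is on the number of places where [h] and [g] differ. *)
Lemma lift_eq0 h g : injective h -> Phi (ecols F h) = 0 -> Phi (ecols F g) = 0.
Proof.
move=> hI h0; have [/injectiveP gI|/injectivePn[a [b ab /(lift_alt ab)]]//] :=
  boolP (injectiveb g).
have [n] := ubnP #|[pred b | h b != g b]|.
elim: n h hI h0 => // n IH h hI h0; rewrite ltnS => hn.
have [/forallP hg|/forallPn[b hgb]] := boolP [forall b, h b == g b].
  by rewrite -(_ : h = g) //; apply/funext => b; apply/eqP.
have [/existsP[c /eqP hc]|nc] := boolP [exists c, h c == g b].
  have bc : b != c by apply: contraNneq hgb => bc; rewrite -hc bc.
  apply: (IH (h \o tperm b c)); first exact: (inj_comp hI (@perm_inj _ _)).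
    by rewrite lift_swap // h0 oppr0.
  apply: leq_trans hn; apply: proper_card; apply/properP; split.
    apply/subsetP => d; rewrite !inE /=; case: tpermP => [->|->|//].
      by rewrite hc eqxx.
    by rewrite hc (inj_eq gI).
  by exists b; rewrite !inE //= tpermL hc eqxx.
apply: (IH (upd h b (g b))).
- move=> c d; rewrite /upd; case: eqP => [->|_]; case: eqP => [->//|_].
  + by move=> E; case/existsP: nc; exists d; rewrite E.
  + by move=> E; case/existsP: nc; exists c; rewrite E.
  + exact: hI.
(* As [h] is injective, this matrix unit changes column [b] only and yields a single term. *)
- have := lift_delta (g b) (h b) h; rewrite h0 (rep0r rK) (big_pred1 b) //.
  by move=> j; rewrite (inj_eq hI).
apply: leq_trans hn; apply: proper_card; apply/properP; split.
  apply/subsetP => d; rewrite !inE /upd.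
  by have [->|//] := eqVneq d b; rewrite eqxx.
by exists b; rewrite !inE // /upd !eqxx.
Qed.

Definition wedge_lift (x : ext_power F N k) : V :=
  \sum_s x s *: Phi (ext_basis F s).

Lemma lift_linear : linear wedge_lift.
Proof.
move=> a x y; rewrite /wedge_lift scaler_sumr -big_split; apply: eq_bigr => s _.
by rewrite !ffunE; module.
Qed.

(** The difference [Psi] of the sides is multilinear, so basis columns suffice. Both sides vanish on
    repeated columns and change sign under swaps, which reduces to an increasing tuple, where
    [wedge] is a coordinate vector. *)
Lemma lift_wedge M : wedge_lift (wedge M) = Phi M.
Proof.
apply/eqP; rewrite -subr_eq0; apply/eqP.
pose Psi M := wedge_lift (wedge M) - Phi M; rewrite -/(Psi M).
have lN x : wedge_lift (- x) = - wedge_lift x.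
  by rewrite /wedge_lift -sumrN; apply: eq_bigr => s _; rewrite ffunE scaleNr.
have l0 : wedge_lift 0 = 0.
  by rewrite /wedge_lift big1 // => s _; rewrite ffunE scale0r.
apply: multilinear_eq0 => [L j a u w|h].
  by rewrite /Psi wedge_multilinear lift_linear ML; module.
have [/injectiveP hI|/injectivePn[a [b ab hab]]] := boolP (injectiveb h).
  have [s [p sp]] := incr_sort hI.
  have sw g a b : injective g -> a != b ->
      Psi (ecols F (g \o tperm a b)) = - Psi (ecols F g).
    by move=> gI ab; rewrite /Psi wedge_swap // lift_swap // lN; module.
  have : Psi (ecols F (h \o p)) = 0.
    have -> : ecols F (h \o p) = ext_basis F s.
      by apply/matrixP => i j; rewrite !mxE sp.
    rewrite /Psi /wedge_lift (bigD1 s) //= big1 => [|t ts].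
      by rewrite wedge_ext_basis eqxx; module.
    by rewrite wedge_ext_basis eq_sym (negPf ts) scale0r.
  (* Each transposition in [p] only changes the sign of [Psi], so the vanishing passes from [h \o p]
     to [h]. *)
  case: (prod_tpermP p) => ts {sp} -> ; elim: ts => [|[a b] ts IH] /=.
    move=> _; rewrite big_nil => E; rewrite -E; congr (Psi (ecols F _)).
    by apply/funext => i; rewrite /= perm1.
  case/andP=> ab tsP E; apply: IH => //; apply: oppr_inj; rewrite oppr0 -E.
  rewrite -(sw _ a b) //; last exact: (inj_comp hI (@perm_inj _ _)).
  congr (Psi (ecols F _)); apply/funext => i.
  by rewrite big_cons /= permM.
by rewrite /Psi (wedge_alt F ab) // (lift_alt ab) // l0 subr0.
Qed.

Lemma lift_equivariant A x : wedge_lift (ext_act A x) = rho A (wedge_lift x).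
Proof.
have lZ a y : wedge_lift (a *: y) = a *: wedge_lift y.
  rewrite /wedge_lift scaler_sumr; apply: eq_bigr => s _.
  by rewrite ffunE scalerA.
have lD y z : wedge_lift (y + z) = wedge_lift y + wedge_lift z.
  by have := lift_linear 1 y z; rewrite !scale1r.
have l0 : wedge_lift 0 = 0 by rewrite -(scale0r 0) lZ scale0r.
rewrite /ext_act (big_morph _ lD l0) {2}/wedge_lift (rep_sumr rK).
apply: eq_bigr => s _; rewrite lZ (repZr rK) (big_morph _ lD l0) EQ.
by under eq_bigr do rewrite lift_wedge.
Qed.

Lemma lift_weight s i : rho (delta_mx i i) (Phi (ext_basis F s)) =
  (i \in val s)%:R *: Phi (ext_basis F s).
Proof.
rewrite lift_delta -/(ecols F _).
have [/tnthP[j ->]|ni] := boolP (i \in _).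
  rewrite (big_pred1 j) ?upd_id ?scale1r // => l.
  by rewrite (inj_eq (@incr_inj _ _ s)).
rewrite big_pred0 ?scale0r // => j; apply: contraNF ni => /eqP <-.
exact: mem_tnth.
Qed.

(** The vectors [Phi (ext_basis F s)] are nonzero by [lift_eq0] and have distinct weights under the
    [E_ii], so they are independent. *)
Lemma wedge_lift_inj M : Phi M <> 0 -> injective wedge_lift.
Proof.
move=> M0; have Phi0 s : Phi (ext_basis F s) != 0.
  apply/eqP => s0; apply/M0/(multilinear_eq0 ML) => h.
  exact: lift_eq0 (@incr_inj _ _ s) s0.
suff z x : wedge_lift x = 0 -> x = 0.
  move=> x y E; apply/eqP; rewrite -subr_eq0; apply/eqP/z.
  by rewrite addrC -scaleN1r lift_linear E; module.
move=> x0; apply/ffunP => s; rewrite ffunE.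
suff : x s *: Phi (ext_basis F s) = 0.
  by move/eqP; rewrite scaler_eq0 (negPf (Phi0 s)) orbF => /eqP.
(* The relation is restricted to the [t] agreeing with [s] on [r], one index at a time: [E_ii] keeps
   the terms with [i] in [t], and subtraction keeps the others. *)
pose P (r : seq 'I_N) (t : incr_tuple N k) :=
  all (fun i => (i \in val t) == (i \in val s)) r.
have S r : \sum_(t | P r t) x t *: Phi (ext_basis F t) = 0.
  elim: r => [|i r IH]; first exact: x0.
  have IH' : \sum_(t | P r t)
      (i \in val t)%:R *: (x t *: Phi (ext_basis F t)) = 0.
    have := congr1 (rho (delta_mx i i)) IH.
    rewrite (rep0r rK) (rep_sumr rK) => E; rewrite -[RHS]E.
    by apply: eq_bigr => t _; rewrite (repZr rK) lift_weight; module.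
  rewrite (eq_bigl (fun t => P r t && ((i \in val t) == (i \in val s)))).
  2: by move=> t; rewrite /P /= andbC.
  rewrite big_mkcondr /=; case: (i \in val s).
    rewrite -[RHS]IH'; apply: eq_bigr => t _.
    by case: (i \in _); rewrite ?scale1r ?scale0r.
  have := f_equal2 (fun a b : V => a - b) IH IH'.
  rewrite subrr -sumrB => E; rewrite -[RHS]E; apply: eq_bigr => t _.
  by case: (i \in _); rewrite ?scale1r ?scale0r ?subrr ?subr0.
rewrite -[RHS](S (enum 'I_N)) (big_pred1 s) // => t.
apply/idP/eqP => [/allP ts|->]; last by apply/allP => i _.
apply: incr_subset_eq => i it; rewrite -(eqP (ts i _)) ?mem_enum //.
Qed.

End LiftBasis.

(** * Irreducible modules satisfying the quadratic relations *)

Section Classification.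
Variables (F : fieldType) (N : nat).
Hypothesis charF : [pchar F] =i pred0.
Variables (V : lmodType F) (rho : 'M[F]_N -> V -> V).

Lemma lie_rep_on : lie_module (@gl_bracket F N) rho -> rep_on rho (fun=> True).
Proof.
case=> rL rR rB; split=> // A B v _.
have rD X Y : rho (X - Y) v = rho X v - rho Y v.
  by have := rL v (-1) Y X; rewrite !scaleN1r ![- _ + _]addrC.
by have := rB A B v; rewrite /gl_bracket rD -addrA => ->; module.
Qed.

(** The degree [k] is the number of [E_ii] acting by 1 on a joint eigenvector. [wedge_lift] is
    injective by weights and surjective because its image is a nonzero submodule. *)
Lemma ext_classification : irreducible_module (@gl_bracket F N) rho ->
  (forall w v, wedge_like rho (fun s => rho (s *m w^T) v)) ->
  exists2 k, (k <= N)%N & isomorphic_modules rho (@ext_act F N k).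
Proof.
case=> /lie_rep_on rK [v0 v0n] irr T.
have [v1 [c [_ v1n cv1 _]]] := joint_eigenvector rK (fun w v _ => T w v) I v0n.
pose k := (\sum_i c i)%N.
have deg v : rho 1%:M v = k%:R *: v.
  (* The identity matrix is central, so its eigenspace is a submodule; it contains [v1]. *)
  have [|z|//] := irr (fun v => rho 1%:M v = k%:R *: v).
  - split=> [|a u w Eu Ew|A u Eu]; first by rewrite (rep0r rK) scaler0.
      by rewrite (repPr rK) Eu Ew; module.
    by rewrite (repC rK) // mul1mx mulmx1 Eu (repZr rK); module.
  - by case: v1n; apply: z; exact: (eigen_deg rK I cv1).
exists k.
  by rewrite -[leqRHS]card_ord -sum1_card leq_sum // => i; case: (c i).
have Hk : ext_type k rho (fun=> True) by split.
have [Phi [ML EQ _ [M M0]]] := ext_lift charF Hk I v0n.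
pose f := wedge_lift Phi.
have fL : linear f := lift_linear Phi.
have fE : forall A x, f (ext_act A x) = rho A (f x) :=
  lift_equivariant charF rK T ML EQ.
have fI : injective f := wedge_lift_inj charF rK T ML EQ M0.
have fS v : exists x, f x = v.
  have [|z|] := irr (fun v => exists x, f x = v).
  - split=> [|a u w [x <-] [y <-]|A u [x <-]].
    + by exists 0; have := fL (-1) 0 0; rewrite !scaleN1r !addNr.
    + by exists (a *: x + y); rewrite fL.
    + by exists (ext_act A x); rewrite fE.
  - case: M0; apply: z; exists (wedge M).
    exact: (lift_wedge charF rK T ML EQ).
  - exact.
pose g v := projT1 (cid (fS v)).
have gK : cancel g f by move=> v; rewrite /g; case: cid.
have fK : cancel f g by move=> x; apply: fI; rewrite gK.
have gL : linear g by move=> a u v; apply: fI; rewrite fL !gK.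
pose gl : {linear V -> ext_power F N k} :=
  HB.pack g (GRing.isLinear.Build F V _ _ g gL).
exists gl; split; first by exists f.
by move=> A v; apply: fI; rewrite fE !gK.
Qed.

End Classification.

Lemma Der_linearE (F : fieldType) (A : comAlgType F) a (d e : Der A) (f : A) :
  (a *: d + e) f = a *: d f + e f.
Proof. by []. Qed.

(** * The Lie algebra action on [V (x) A_N] *)

Section TensorAction.
Variables (F : fieldType) (N : nat).
Hypothesis charF : [pchar F] =i pred0.
Variables (V : lmodType F) (beta : 'cV[F]_N) (rho : 'M[F]_N -> V -> V).
Hypothesis lieV : lie_module (@gl_bracket F N) rho.
Implicit Types (d e : Der (laurent F N)) (x y : tens V N) (k l r : 'cV[int]_N).
Implicit Types (u w s : 'cV[F]_N) (v : V).

Let rK := lie_rep_on lieV.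

Lemma cvFD k l : cvF F (k + l) = cvF F k + cvF F l.
Proof. exact: map_mxD. Qed.

Lemma cvFB k l : cvF F (k - l) = cvF F k - cvF F l.
Proof. exact: map_mxB. Qed.

Lemma cvF0 : cvF F (0 : 'cV[int]_N) = 0.
Proof. exact: map_mx0. Qed.

Lemma cvF_evec (i : 'I_N) : cvF F (evec i) = delta_mx i 0.
Proof. exact: map_delta_mx. Qed.

Lemma F_act_linear d : linear (F_act beta rho d).
Proof.
apply: (tens_ext_linear (phi := fun k v => \sum_(r <- W_supp d)
  let u := W_coef d r in
  tmon (dot u (cvF F k + beta) *: v + rho (cvF F r *m u^T) v) (k + r))).
move=> k a v v'; rewrite scaler_sumr -big_split; apply: eq_bigr => r _ /=.
rewrite -tmon_linear; congr (tmon _ _).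
by rewrite (repPr rK); module.
Qed.

Lemma W_coefP a d e r : W_coef (a *: d + e) r = a *: W_coef d r + W_coef e r.
Proof. by apply/colP => i; rewrite !mxE Der_linearE tcoefD tcoefZ. Qed.

Lemma F_act_derP a d e x :
  F_act beta rho (a *: d + e) x = a *: F_act beta rho d x + F_act beta rho e x.
Proof.
rewrite /F_act scaler_sumr -big_split; apply: eq_bigr => k _ /=.
pose f d r : tens V N := tmon (dot (W_coef d r) (cvF F k + beta) *: tcoef x k
          + rho (cvF F r *m (W_coef d r)^T) (tcoef x k)) (k + r).
(* [W_supp] depends on the derivation, so the three sums are first extended to a common finite
   set. *)
have ext d' (E : {fset 'cV[int]_N}) : (W_supp d' `<=` E)%fset ->
    \sum_(r <- W_supp d') f d' r = \sum_(r <- E) f d' r.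
  move=> sE; apply: big_fset_incl => // r _ /W_coef_dflt rd; rewrite /f rd.
  rewrite trmx0 mulmx0 (rep0l rK) // dotC dot0 scale0r addr0.
  by apply/tensP => l; rewrite tcoef_mon tcoef_fs0; case: ifP.
rewrite -![\sum_(r <- W_supp _) _]/(\sum_(r <- W_supp _) f _ r).
pose E := (W_supp d `|` W_supp e `|` W_supp (a *: d + e)%R)%fset.
rewrite !(@ext _ E); first last.
1-3: by apply/fsubsetP => k' kx; rewrite !in_fsetU kx ?orbT.
rewrite scaler_sumr -big_split; apply: eq_bigr => r _ /=.
rewrite /f -tmon_linear W_coefP; congr (tmon _ _).
rewrite ![dot _ (_ + beta)]dotC dotP linearP /= mulmxDr -scalemxAr.
by rewrite (repPl rK) //; module.
Qed.

Lemma D_bracket_tpow u r w l k :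
  D_fun u r (D_fun w l (tpow F k)) - D_fun w l (D_fun u r (tpow F k)) =
  D_fun (dot u (cvF F l) *: w - dot w (cvF F r) *: u) (r + l) (tpow F k).
Proof.
have DZ u' r' a (f : laurent F N) : D_fun u' r' (a *: f) = a *: D_fun u' r' f.
  by rewrite (GRing.scalable_linear (D_fun_linear u' r')).
rewrite !D_funE !DZ !D_funE !cvFD ![dot _ (_ + _)]dotD.
rewrite dotBl !dotZl [k + (r + l)]addrA [k + l + r]addrAC; module.
Qed.

Lemma der_bracket_D u r w l :
  der_bracket (D u r) (D w l) =
  D (dot u (cvF F l) *: w - dot w (cvF F r) *: u) (r + l).
Proof.
apply/val_inj/funext/laurent_linear_eq; try exact: der_linear.
exact: D_bracket_tpow.
Qed.

(** The commutator of [r u^T] and [l w^T] is [(u|l) r w^T - (w|r) l u^T]; the remaining terms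
    [(u|l) l w^T - (w|r) r u^T] come from the shift of degree in the scalar factors. *)
Lemma F_act_tmon_bracket u r w l k v :
  F_act beta rho (der_bracket (D u r) (D w l)) (tmon v k) =
  F_act beta rho (D u r) (F_act beta rho (D w l) (tmon v k)) -
  F_act beta rho (D w l) (F_act beta rho (D u r) (tmon v k)).
Proof.
rewrite der_bracket_D !F_act_D // [k + (r + l)]addrA [k + l + r]addrAC.
rewrite [RHS]addrC -[- tmon _ _]scaleN1r -tmon_linear; congr (tmon _ _).
have trE a b : (a *: w - b *: u)^T = a *: w^T - b *: u^T.
  by rewrite linearB !linearZ.
rewrite trE mulmxBr -!scalemxAr !cvFD !mulmxDl dotBl !dotZl !dotD.
rewrite !(repDr rK) !(repZr rK).
rewrite (repC rK (cvF F r *m u^T) (cvF F l *m w^T)) // !outer_mul.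
rewrite scalerDr scalerDr opprD -!scaleNr.
rewrite !(repDl rK) // !(repZl rK) //; module.
Qed.

(** The bracket relation is bilinear in the derivations, which are sums of [D u r] by [derE]; on
    these and on pure tensors it is [F_act_tmon_bracket]. *)
Lemma F_act_lie_module :
  lie_module (@der_bracket F (laurent F N)) (F_act beta rho).
Proof.
split=> [x a d e|d|]; [exact: F_act_derP|exact: F_act_linear|].
have dB (d1 d2 e : Der (laurent F N)) :
    der_bracket (d1 + d2) e = der_bracket d1 e + der_bracket d2 e.
  apply/val_inj/funext => f.
  rewrite -[LHS]/((d1 + d2) (e f) - e ((d1 + d2) f)).
  rewrite -[RHS]/((d1 (e f) - e (d1 f)) + (d2 (e f) - e (d2 f))).
  have dE g : (d1 + d2) g = d1 g + d2 g.
    by have := Der_linearE 1 d1 d2 g; rewrite !scale1r.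
  by rewrite !dE linearD opprD addrACA.
have dN d e : der_bracket e d = - der_bracket d e.
  by apply/val_inj/funext => f; apply/esym/opprB.
have Fd0 x : F_act beta rho 0 x = 0.
  by have := F_act_derP (-1) 0 0 x; rewrite !scaleN1r !addNr.
have FdD d1 d2 x : F_act beta rho (d1 + d2) x =
    F_act beta rho d1 x + F_act beta rho d2 x.
  by have := F_act_derP 1 d1 d2 x; rewrite !scale1r.
have FdN d x : F_act beta rho (- d) x = - F_act beta rho d x.
  by have := F_act_derP (-1) d 0 x; rewrite !scaleN1r Fd0 !addr0.
have Fx0 d : F_act beta rho d 0 = 0.
  by have := F_act_linear d (-1) 0 0; rewrite !scaleN1r !addNr.
have FxD d x y : F_act beta rho d (x + y) =
    F_act beta rho d x + F_act beta rho d y.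
  by have := F_act_linear d 1 x y; rewrite !scale1r.
pose P d e := forall x, F_act beta rho (der_bracket d e) x =
  F_act beta rho d (F_act beta rho e x) - F_act beta rho e (F_act beta rho d x).
have PC d e : P d e -> P e d by move=> Pde x; rewrite dN FdN Pde opprB.
have P0 e : P 0 e.
  move=> x; have d0 : der_bracket 0 e = 0.
    by apply: (addrI (der_bracket 0 e)); rewrite -dB !addr0.
  by rewrite d0 !Fd0 Fx0 subrr.
have PD d1 d2 e : P d1 e -> P d2 e -> P (d1 + d2) e.
  by move=> P1 P2 x; rewrite dB !FdD P1 P2 FxD; module.
have gen e : (forall u r, P (D u r) e) -> forall d, P d e.
  move=> Pe d; rewrite [d]derE.
  by apply: (big_ind (fun d => P d e)) => // d1 d2; apply: PD.
suff PDD u r w l : P (D u r) (D w l).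
  by move=> d e; apply: (gen) => u r; apply: PC; apply: gen => w l.
have fgL (f g : tens V N -> tens V N) : linear f -> linear g ->
    linear (fun x => f (g x) - g (f x)).
  by move=> fL gL a x y; rewrite !(fL, gL); module.
exact: (tens_linear_eq (F_act_linear _)
  (fgL _ _ (F_act_linear _) (F_act_linear _)) (F_act_tmon_bracket u r w l)).
Qed.

Lemma F_act_D0 u x l : tcoef (F_act beta rho (D u 0) x) l =
  dot u (cvF F l + beta) *: tcoef x l.
Proof.
apply: (tens_linear_eq (f := fun x => tcoef (F_act beta rho (D u 0) x) l)
  (g := fun x => dot u (cvF F l + beta) *: tcoef x l)) => [a y z|a y z|k v].
- by rewrite F_act_linear tcoefD tcoefZ.
- by rewrite tcoefD tcoefZ; module.
rewrite F_act_D // cvF0 mul0mx (rep0l rK) // !addr0 !tcoef_mon.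
by case: eqP => [->|]; rewrite ?scaler0.
Qed.

Lemma intr_char0 (z : int) : z != 0 -> z%:~R != 0 :> F.
Proof.
have natr n : n.+1%:R != 0 :> F by rewrite ((pcharf0P _).1 charF).
by case: z => [[|n]|n] //= _; rewrite ?NegzE ?mulrNz ?oppr_eq0 natr.
Qed.

(** * Homogeneous components of a submodule *)

Section Submodule.
Variable U : tens V N -> Prop.
Hypothesis subU : submodule (F_act beta rho) U.

(* [U] is graded: the operators [D(u, 0)] separate the degrees. *)
Lemma sub_graded x k : U x -> U (tmon (tcoef x k) k).
Proof.
case: subU => U0 UP UA Ux.
suff [y [Uy yk y0 yr]] : exists y, [/\ U y, tcoef y k = tcoef x k,
    forall l, tcoef x l = 0 -> tcoef y l = 0 &
    forall l, l \in [seq l <- tsupp x | l != k] -> tcoef y l = 0].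
  suff <- : y = tmon (tcoef x k) k by [].
  apply/tensP => l; rewrite tcoef_mon; have [-> //|lk] := eqVneq l k.
  have [xl|xl] := boolP (l \in tsupp x).
    by apply: yr; rewrite mem_filter lk.
  exact/y0/tcoef_dflt.
have: all (predC1 k) [seq l <- tsupp x | l != k].
  by apply/allP => l; rewrite mem_filter => /andP[].
elim: [seq _ <- _ | _] => [_|l r IH /= /andP[lk /IH{IH}[y [Uy yk y0 yr]]]].
  by exists x; split.
have [i ki] : exists i, k i 0 - l i 0 != 0.
  apply: contrapT => /forallNP h; case/eqP: lk; apply/colP => i.
  by apply/eqP; rewrite eq_sym -subr_eq0; apply/negPn/negP/h.
(* The eigenvalues of [D u 0] in degrees [k] and [l] differ by the nonzero integer [k i 0 - l i 0];
   [beta] cancels. *)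
pose u : 'cV[F]_N := delta_mx i 0; pose a := dot u (cvF F l + beta).
pose b := (k i 0 - l i 0)%:~R : F.
have ab : dot u (cvF F k + beta) - a = b.
  rewrite /a !dotD opprD addrACA subrr addr0 -dotN -dotD -cvFB.
  by rewrite /dot trmx_delta -rowE !mxE.
(* This kills degree [l], fixes degree [k] and keeps zero coefficients zero. *)
exists (b^-1 *: (F_act beta rho (D u 0) y + (- a) *: y)).
have E m : tcoef (b^-1 *: (F_act beta rho (D u 0) y + (- a) *: y)) m =
    (b^-1 * (dot u (cvF F m + beta) - a)) *: tcoef y m.
  by rewrite tcoefZ tcoefD tcoefZ F_act_D0; module.
split.
- rewrite -[_ *: _]addr0; apply: (UP) => //; rewrite addrC; apply: UP => //.
  exact: UA.
- by rewrite E ab mulVf ?intr_char0 // scale1r.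
- by move=> m /y0 ym; rewrite E ym scaler0.
- move=> m; rewrite inE => /orP[/eqP ->|/yr ym]; rewrite E ?ym ?scaler0 //.
  by rewrite -/a subrr mulr0 scale0r.
Qed.

Definition layer k v := U (tmon v k).

Lemma layer0 k : layer k 0.
Proof.
rewrite /layer (_ : tmon 0 k = 0); first by case: subU.
by apply/tensP => l; rewrite tcoef_mon tcoef_fs0; case: ifP.
Qed.

Lemma layerP k a v v' : layer k v -> layer k v' -> layer k (a *: v + v').
Proof.
by case: subU => _ UP _ kv kw; rewrite /layer tmon_linear; apply: UP.
Qed.

Lemma layerD k v v' : layer k v -> layer k v' -> layer k (v + v').
Proof. by move=> kv kw; rewrite -[v]scale1r; apply: layerP. Qed.

Lemma layerZ k a v : layer k v -> layer k (a *: v).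
Proof.
by move=> kv; rewrite -[_ *: _]addr0; apply: layerP => //; apply: layer0.
Qed.

Lemma layerB k v v' : layer k v -> layer k v' -> layer k (v - v').
Proof. by move=> kv kw; rewrite -scaleN1r; apply/layerD/layerZ. Qed.

Lemma layer_D k r u v : layer k v ->
  layer (k + r) (dot u (cvF F k + beta) *: v + rho (cvF F r *m u^T) v).
Proof. by case: subU => _ _ UA kv; rewrite /layer -F_act_D //; apply: UA. Qed.

(* [D(u, r - s) D(w, s)] sends [v (x) t^k] to [g s (x) t^(k + r)] with [g]
   quadratic in [s]; the statement is about its second difference, which does
   not depend on [r]. *)
Lemma layer_second_difference k m p q u w v : layer k v ->
  layer m (dot u (cvF F p) *: rho (cvF F q *m w^T) v
         - rho (cvF F p *m u^T) (rho (cvF F q *m w^T) v)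
         + (dot u (cvF F q) *: rho (cvF F p *m w^T) v
         - rho (cvF F q *m u^T) (rho (cvF F p *m w^T) v))).
Proof.
move=> kv.
(* Here [l] is the shift by the first operator; the second one shifts by [m - (k + l)], so every
   [g l] ends in degree [m]. *)
pose y l := dot w (cvF F k + beta) *: v + rho (cvF F l *m w^T) v.
pose g l := dot u (cvF F (k + l) + beta) *: y l
          + rho (cvF F (m - (k + l)) *m u^T) (y l).
have gm l : layer m (g l).
  rewrite -[m in layer m](subrKC (k + l)).
  by apply/layer_D/layer_D.
(* All terms of degree at most 1 in [l] cancel, among them those containing [m]. *)
have := layerD (layerB (layerB (gm (p + q)) (gm p)) (gm q)) (gm 0).
congr layer; rewrite /g /y !cvFB !cvFD !cvF0 !(dotD, dot0).
rewrite !(mulmxBl, mulmxDl, mul0mx) !(repDr rK, repZr rK).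
do !rewrite ?(repBl rK) ?(repDl rK) ?(rep0l rK) ?(rep0r rK) ?(repDr rK) //.
module.
Qed.

(** Acting by [D(e_j, e_i)] from degree [m - e_i] gives [E_ij v] plus a multiple of [v], and [v]
    itself lies in layer [m]. *)
Lemma layer_all_submodule :
  submodule rho (fun v => forall m, layer m v).
Proof.
split=> [m|a v v' lv lv' m|A v lv m]; [exact: layer0|exact: layerP|].
have E i j : layer m (rho (delta_mx i j) v).
  have := layer_D (evec i) (delta_mx j 0) (lv (m - evec i)).
  rewrite subrK cvF_evec -delta_outer => h.
  set a := dot _ _ in h; rewrite -[rho _ v](addKr (a *: v)) addrC.
  by apply: layerB => //; apply: layerZ.
have layer_sum I (r : seq I) (f : I -> V) :
    (forall i, layer m (f i)) -> layer m (\sum_(i <- r) f i).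
  by move=> fm; apply: big_ind => //; [exact: layer0|exact: layerD].
rewrite [A]matrix_sum_delta (rep_suml rK) //; apply: (layer_sum) => i.
rewrite (rep_suml rK) //; apply: (layer_sum) => j.
by rewrite (repZl rK) //; apply: layerZ.
Qed.

End Submodule.

(** This passes from lattice vectors to all of [C^N]: the relation is quadratic in [s], so its
    polarization at unit vectors determines it, as 2 is invertible. *)
Lemma wedge_like_pol_eq0 w v :
  (forall i j u, let z (c : 'I_N) := rho (delta_mx c 0 *m w^T) v in
    dot u (delta_mx i 0) *: z j - rho (delta_mx i 0 *m u^T) (z j)
    + (dot u (delta_mx j 0) *: z i - rho (delta_mx j 0 *m u^T) (z i)) = 0) ->
  wedge_like rho (fun s => rho (s *m w^T) v).
Proof.
move=> pol s u.
have rE w' v' :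
    rho (s *m w'^T) v' = \sum_i s i 0 *: rho (delta_mx i 0 *m w'^T) v'.
  rewrite {1}[s]cV_sum_delta mulmx_suml (rep_suml rK) //.
  by apply: eq_bigr => i _; rewrite -scalemxAl (repZl rK).
pose z (c : 'I_N) := rho (delta_mx c 0 *m w^T) v.
pose q i j := dot u (delta_mx i 0) *: z j - rho (delta_mx i 0 *m u^T) (z j).
pose Q := dot u s *: rho (s *m w^T) v - rho (s *m u^T) (rho (s *m w^T) v).
have QE : Q = \sum_i \sum_j (s i 0 * s j 0) *: q i j.
  rewrite /Q dotE scaler_suml [rho (s *m u^T) _]rE -sumrB.
  apply: eq_bigr => i _.
  rewrite [rho (s *m w^T) v]rE (rep_sumr rK) !scaler_sumr -sumrB.
  apply: eq_bigr => j _; rewrite (repZr rK) /q dotC dotE.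
  rewrite (bigD1 i) //= big1 => [|l li]; last by rewrite !mxE (negPf li) mul0r.
  by rewrite !mxE !eqxx; module.
(* Exchanging the summations in one copy pairs [q i j] with [q j i], as in the hypothesis. *)
have QQ : Q + Q = 0.
  rewrite {2}QE exchange_big QE -big_split big1 // => i _ /=.
  rewrite -big_split big1 // => j _ /=.
  by rewrite [s j 0 * _]mulrC -scalerDr pol scaler0.
suff Q0 : Q = 0 by apply/eqP; rewrite eq_sym -subr_eq0; apply/eqP.
have : 2%:R *: Q = 0 by rewrite scaler_nat mulr2n.
by move/eqP; rewrite scaler_eq0 ((pcharf0P _).1 charF) /= => /eqP.
Qed.

(** For [rho A v], the map attached to [w] is [hom_act A] of the map for [v] and [w], plus the map
    for [v] and [A^T w]; both summands are [wedge_like]. *)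
Lemma wedge_like_submodule : submodule rho
  (fun v => forall w, wedge_like rho (fun s => rho (s *m w^T) v)).
Proof.
split=> [w s u|a v v' Tv Tv' w s u|A v Tv w].
- by rewrite !(rep0r rK) scaler0.
- by rewrite !(repPr rK) Tv Tv'; module.
have L w' : linear (fun s : 'cV[F]_N => rho (s *m w'^T) v).
  by move=> a s t; rewrite mulmxDl -scalemxAl (repPl rK).
have E s : rho (s *m w^T) (rho A v) =
    hom_act rho A (fun s => rho (s *m w^T) v) s + rho (s *m (A^T *m w)^T) v.
  by rewrite /hom_act (repC rK) // mul_outer mulmxA; module.
move=> s u; rewrite !E (repDr rK) Tv.
by rewrite (hom_act_wedge_like rK A (L w) (fun=> I) (Tv w)); module.
Qed.

Lemma F_act_irreducible : irreducible_module (@gl_bracket F N) rho ->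
  (forall n : nat, (n <= N)%N -> ~ isomorphic_modules rho (@ext_act F N n)) ->
  irreducible_module (@der_bracket F (laurent F N)) (F_act beta rho).
Proof.
move=> irrV nonext; have [_ [v0 v0n] irr] := irrV.
split; first exact: F_act_lie_module.
  exists (tmon v0 0) => /(congr1 (fun x => tcoef x 0)).
  by rewrite tcoef_mon eqxx tcoef_fs0.
move=> U subU; have [U0|/existsNP[x /not_implyP[Ux x0]]] :=
  pselect (forall x, U x -> x = 0); [by left|right].
(* If every vector lies in all layers, then [U] contains all pure tensors. *)
have [X0|XV] := irr _ (layer_all_submodule subU); last first.
  move=> y; rewrite [y]tensE; case: (subU) => U0 UP _.
  apply: big_ind => // [a b Ua Ub|k _]; last exact: XV.
  by rewrite -[a]scale1r; apply: UP.
have [k xk] : exists k, tcoef x k <> 0.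
  apply: contrapT => /forallNP h; apply/x0/tensP => k.
  by rewrite [RHS]tcoef_fs0; apply: (contrapT (h k)).
have kv : layer U k (tcoef x k) := sub_graded subU k Ux.
(* Otherwise the second differences vanish at the nonzero vector [tcoef x k], so the quadratic
   relations hold on a nonzero submodule. *)
have [Tz|Tall] := irr _ wedge_like_submodule.
  case: xk; apply: Tz => w; apply: wedge_like_pol_eq0 => i j u /=.
  rewrite -!cvF_evec; apply: X0 => m.
  exact: (layer_second_difference subU m (evec i) (evec j) u w kv).
have [n nN iso] := ext_classification charF irrV (fun w v => Tall v w).
by case: (nonext n nN iso).
Qed.

End TensorAction.

Theorem theorem8p3 (R : realType) (N : nat) (hN : (1 < N)%N)
    (beta : 'cV[R[i]]_N) (V : lmodType R[i]) (rho : 'M[R[i]]_N -> V -> V) :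
  irreducible_module (@gl_bracket R[i] N) rho ->
  (forall k : nat, (k <= N)%N ->
     ~ isomorphic_modules rho (@ext_act R[i] N k)) ->
  irreducible_module (@der_bracket R[i] (laurent R[i] N)) (F_act beta rho).
Proof.
move=> irrV; have [lieV _ _] := irrV.
exact: (F_act_irreducible (@Num.Theory.pchar_num R[i]) beta lieV irrV).
Qed.
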